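(* Let $d\ge1$ be an integer, $m\ge1$ and $\beta>0$ real, let $Y$ be a complex Banach space, and let $F\in\{F^{p}_{m,\beta}(Y),\,F^{\infty,0}_{m,\beta}(Y)\}$, where $1\le p<\infty$. If $f$ is in $F$, there exists a sequence of holomorphic $Y$-valued polynomials $(p_n)_n$ such that $\|f-p_n\|_F$ tends to $0$ as $n\to+\infty$.
   Context: $F^p_{m,\beta}(Y)$ is the space of $Y$-valued entire functions $f$ on $\mathbb{C}^d$ with $\|f\|^p_{F^p_{m,\beta}(Y)}=c_{m,\beta}\int_{\mathbb{C}^d}\|f(\zeta)e^{-\frac{\beta}{2}|\zeta|^{2m}}\|_Y^p\,dv(\zeta)<\infty$ if $1\le p<\infty$, where $dv$ is Lebesgue measure on $\mathbb{C}^d$ and $c_{m,\beta}=\frac{m\beta^{d/m}}{\pi^d}\frac{\Gamma(d)}{\Gamma(d/m)}$. $F^{\infty,0}_{m,\beta}(Y)$ is the space of $Y$-valued entire functions $f$ on $\mathbb{C}^d$ with $\lim_{|\zeta|\to\infty}\|f(\zeta)\|_Ye^{-\frac{\beta}{2}|\zeta|^{2m}}=0$, with norm $\sup_{\zeta}\|f(\zeta)\|_Ye^{-\frac{\beta}{2}|\zeta|^{2m}}$. *)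

(* Defs.v *)
(* The scalar field is R[i] for an arbitrary R : realType. *)
From HB Require Import structures.
From mathcomp Require Import all_boot all_order all_algebra.
From mathcomp Require Import all_classical all_reals all_analysis.
From mathcomp Require Import complex.

Set Implicit Arguments.
Unset Strict Implicit.
Unset Printing Implicit Defensive.

Import Order.TTheory GRing.Theory Num.Theory.
Import numFieldNormedType.Exports.

Local Open Scope classical_set_scope.
Local Open Scope complex_scope.
Local Open Scope ring_scope.

(* The library's sigma-finiteness instance for \x is shadowed by the one for
   subprobabilities and is not found by inference; this copy carries it. *)
Section sf_product.
Context d1 d2 (T1 : measurableType d1) (T2 : measurableType d2) (R : realType).
Variables (m1 : {sigma_finite_measure set T1 -> \bar R})
          (m2 : {sigma_finite_measure set T2 -> \bar R}).

Definition sf_product : set (T1 * T2)%type -> \bar R := (m1 \x m2)%E.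

HB.instance Definition _ := Measure.on sf_product.

Let sf_product_sigma_finite : sigma_finite setT sf_product.
Proof.
have /sigma_finiteP[F [TF ndF Foo]] := sigma_finiteT m1.
have /sigma_finiteP[G [TG ndG Goo]] := sigma_finiteT m2.
exists (fun n => F n `*` G n).
  rewrite -setXTT TF TG predeqE => -[x y]; split.
    move=> [/= [n _ Fnx] [k _ Gky]]; exists (maxn n k) => //; split.
    - by move: x Fnx; exact/subsetPset/ndF/leq_maxl.
    - by move: y Gky; exact/subsetPset/ndG/leq_maxr.
  by move=> [n _ []/= ? ?]; split; exists n.
move=> k; have [? ?] := Foo k; have [? ?] := Goo k.
split; first exact: measurableX.
by rewrite /sf_product product_measure1E// lte_mul_pinfty// ge0_fin_numE.
Qed.

HB.instance Definition _ := Measure_isSigmaFinite.Build _ _ _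
  sf_product sf_product_sigma_finite.

End sf_product.

Section power_measure.
Context dT (T : measurableType dT) (R : realType).
Variable mu : {sigma_finite_measure set T -> \bar R}.

Definition tcons n (x : T * n.-tuple T) : n.+1.-tuple T :=
  [the n.+1.-tuple T of x.1 :: x.2].

Lemma measurable_tcons n : measurable_fun [set: T * n.-tuple T] (@tcons n).
Proof. exact: measurable_cons. Qed.

Section successor.
Variables (n : nat) (nu : {sigma_finite_measure set (n.-tuple T) -> \bar R}).

Definition cons_measure : set (n.+1.-tuple T) -> \bar R :=
  pushforward (sf_product mu nu) (@tcons n).

Let cons_measure0 : cons_measure set0 = 0%E.
Proof. by rewrite /cons_measure /pushforward preimage_set0 measure0. Qed.

Let cons_measure_ge0 A : (0 <= cons_measure A)%E.
Proof. by rewrite /cons_measure /pushforward; apply: measure_ge0. Qed.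

Let cons_measure_sigma_additive : semi_sigma_additive cons_measure.
Proof.
move=> F mF tF mUF.
have mp (A : set (n.+1.-tuple T)) : measurable A ->
    measurable (@tcons n @^-1` A).
  by move=> mA; rewrite -[X in measurable X]setTI; exact: measurable_tcons.
rewrite /cons_measure /pushforward preimage_bigcup.
apply: measure_semi_sigma_additive.
- by move=> k; exact: mp.
- apply/trivIsetP => /= i j _ _ ij; rewrite -preimage_setI.
  by move/trivIsetP : tF => /(_ _ _ _ _ ij) ->//; rewrite preimage_set0.
- by rewrite -preimage_bigcup; exact: mp.
Qed.

HB.instance Definition _ := isMeasure.Build _ _ _
  cons_measure cons_measure0 cons_measure_ge0 cons_measure_sigma_additive.

Let cons_measure_sigma_finite : sigma_finite setT cons_measure.
Proof.
have [F TF Foo] := sigma_finiteT (sf_product mu nu).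
pose u (t : n.+1.-tuple T) : T * n.-tuple T := (thead t, [tuple of behead t]).
have mu_ : measurable_fun [set: n.+1.-tuple T] u.
  apply/measurable_fun_pairP; split; first exact: measurable_tnth.
  exact: measurable_behead.
have consK : cancel (@tcons n) u.
  by move=> [x t]; congr pair; apply: val_inj.
exists (fun k => u @^-1` F k); first by rewrite -preimage_bigcup -TF.
move=> k; have [mFk Fkoo] := Foo k; split.
  by rewrite -[X in measurable X]setTI; exact: mu_.
rewrite /cons_measure /pushforward -comp_preimage.
by rewrite (_ : u \o _ = id)//; apply/funext => x /=; rewrite consK.
Qed.

HB.instance Definition _ := Measure_isSigmaFinite.Build _ _ _
  cons_measure cons_measure_sigma_finite.

End successor.

Fixpoint power_measure n : {sigma_finite_measure set (n.-tuple T) -> \bar R} :=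
  if n is n'.+1 then cons_measure (power_measure n')
  else \d_([tuple] : 0.-tuple T).

End power_measure.

Section fock.
Variable R : realType.

Definition lebesgue_plane :
    {sigma_finite_measure set (measurableTypeR R * measurableTypeR R)%type
       -> \bar R} :=
  sf_product (@lebesgue_measure R) (@lebesgue_measure R).

(* C^d is identified with (R^2)^d, on which Lebesgue measure is the d-fold
   power of planar Lebesgue measure. *)
Definition lebesgue_Cd (d : nat) :=
  power_measure lebesgue_plane d.

Definition to_Cd (d : nat)
    (t : d.-tuple (measurableTypeR R * measurableTypeR R)) : 'rV[R[i]]_d :=
  \row_i ((tnth t i).1 +i* (tnth t i).2).

(* The library norm on 'rV is the sup norm; the weight uses the Euclidean one. *)
Definition euclid (d : nat) (z : 'rV[R[i]]_d) : R :=
  Num.sqrt (\sum_(i < d) (complex.Re (z 0 i) ^+ 2 + complex.Im (z 0 i) ^+ 2)).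

Definition Gamma (x : R) : R :=
  \int[@lebesgue_measure R]_(t in `]0, +oo[) (t `^ (x - 1) * expR (- t)).

Definition euclid_infty (d : nat) : set_system 'rV[R[i]]_d :=
  filter_from [set: R] (fun M => [set z | M < euclid z]).
Arguments euclid_infty : clear implicits.

Section valued.
Variables (d : nat) (m beta : R) (Y : completeNormedModType R[i]).
Implicit Types f P : 'rV[R[i]]_d -> Y.

(* Norms over R[i] take values in R[i]; they are real, so Re loses nothing. *)
Definition rnorm (y : Y) : R := complex.Re `|y|.

Definition entire f : Prop := forall z, differentiable f z.

Definition weight (z : 'rV[R[i]]_d) : R :=
  expR (- (beta / 2) * euclid z `^ (2 * m)).

Definition fock_const : R :=
  m * beta `^ (d%:R / m) / pi ^+ d * (Gamma d%:R / Gamma (d%:R / m)).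

(* This is the p-th power of the F^p norm; t ranges over (R^2)^d. *)
Definition fock_pow (p : R) f : \bar R :=
  (fock_const%:E * \int[lebesgue_Cd d]_t
     ((rnorm ((weight (to_Cd t))%:C *: f (to_Cd t)) `^ p)%:E))%E.

(* The two norms are defined on all functions, with value +oo allowed. *)
Definition fock_norm (p : R) f : \bar R := (fock_pow p f `^ p^-1)%E.

Definition fock (p : R) f : Prop := entire f /\ (fock_pow p f < +oo)%E.

Definition fock0_norm f : \bar R :=
  ereal_sup (range (fun z => (rnorm (f z) * weight z)%:E)).

Definition fock0 f : Prop :=
  entire f /\ rnorm (f z) * weight z @[z --> euclid_infty d] --> 0.

(* Every exponent runs over [0, N), so N bounds the degree in each variable. *)
Definition vpolynomial P : Prop :=
  exists (N : nat) (a : {ffun 'I_d -> 'I_N} -> Y),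
    forall z, P z = \sum_(alpha : {ffun 'I_d -> 'I_N})
      (\prod_(i < d) z 0 i ^+ alpha i) *: a alpha.

End valued.
End fock.

(* Main.v *)
(* A summability argument. For a root of unity w of order 2^N let f(z; z_j -> w^k z_j)
   denote f with its j-th coordinate rotated; averaging these rotations against
   the Fejer kernel and letting N tend to infinity gives the Fejer mean of f in
   the variable z_j. The means taken successively in all the variables are
   - polynomials, since a discrete Goursat argument (bisection of circulations of
     g o exp, whose period 2 i pi turns segments into circles) shows that the
     averages of x^-l f(z; z_j -> x z_j) behave like z_j^l, and tend to 0 if l < 0;
   - close to f uniformly on polydiscs, and bounded at z by the supremum of |f| on
     the torus through z, on which the weight is constant: this settles F^(oo,0);
   - of F^p norm at most that of f, by Jensen's inequality, the invariance of
     Lebesgue measure under rotations of a coordinate, and Fatou's lemma. With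
     pointwise convergence, a second use of Fatou's lemma gives convergence in F^p. *)
Require Import Defs.
From mathcomp Require Import all_boot all_order all_algebra.
From mathcomp Require Import all_classical all_reals all_analysis.
From mathcomp Require Import measurable_realfun complex ring lra zify.

Set Implicit Arguments.
Unset Strict Implicit.
Unset Printing Implicit Defensive.

Import Order.TTheory GRing.Theory Num.Theory.
Import numFieldNormedType.Exports Normc.

Local Open Scope classical_set_scope.
Local Open Scope complex_scope.
Local Open Scope ring_scope.

(** Averages over roots of unity keep every object a finite sum: no [Y]-valued integral is formed,
    Jensen's inequality is finite, and the only change of variables is a rotation. The number of
    nodes is a power of two because bisection has to be exact for Riemann sums. The Fejer kernel is
    preferred to Taylor truncation because it is nonnegative of mean one, so that the means do not
    increase the norm for any p >= 1, nor the sup norm. The obstacle is that once a variable has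
    been averaged, the new function is known only as a limit, through which differentiability in the
    other variables would have to be carried. Two weaker properties are carried instead: [tame],
    which makes the limits exist uniformly on polydiscs, and [holo], an asymptotic statement on
    averages that passes to locally uniform limits by a direct estimate. *)

Section complex_exponential.
Context {R : realType}.
Implicit Types (x y : R) (z w : R[i]).

(** * Complex modulus, exponential and roots of unity *)

Lemma normcE z : `|z| = (normc z)%:C.
Proof. by case: z. Qed.

Lemma normc_ge0 z : 0 <= normc z.
Proof. by case: z => a b; exact: sqrtr_ge0. Qed.

Lemma normcR x : normc x%:C = `|x|.
Proof. by rewrite /= expr0n /= addr0 sqrtr_sqr. Qed.

Lemma normcX z n : normc (z ^+ n) = normc z ^+ n.
Proof. by elim: n => [|n ih]; rewrite ?expr0 ?normc1// !exprS normcM ih. Qed.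

Lemma normc_eq0 z : (normc z == 0) = (z == 0).
Proof.
by apply/eqP/eqP => [/eq0_normc//|->]; rewrite normc0.
Qed.

Lemma normcB z w : normc (z - w) <= normc z + normc w.
Proof. by rewrite -(normcN w); exact: le_normcD. Qed.

Lemma normc_distC z w : normc (z - w) = normc (w - z).
Proof. by rewrite -opprB normcN. Qed.

Lemma normc_Re z : `|complex.Re z| <= normc z.
Proof.
case: z => a b /=; rewrite -sqrtr_sqr ler_wsqrtr// lerDl; exact: sqr_ge0.
Qed.

Lemma normc_Im z : `|complex.Im z| <= normc z.
Proof.
case: z => a b /=; rewrite -sqrtr_sqr ler_wsqrtr// lerDr; exact: sqr_ge0.
Qed.

Lemma normc_le_ReIm z : normc z <= `|complex.Re z| + `|complex.Im z|.
Proof.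
case: z => a b /=.
rewrite -[leRHS](@ger0_norm _ (`|a| + `|b|)) ?addr_ge0// -sqrtr_sqr ler_wsqrtr//.
rewrite sqrrD !real_normK ?num_real// -addrA lerD2l lerDr mulrn_wge0//.
Qed.

Lemma normc_sum (I : Type) (s : seq I) (F : I -> R[i]) :
  normc (\sum_(i <- s) F i) <= \sum_(i <- s) normc (F i).
Proof.
elim/big_rec2: _ => [|i y x _ ih]; first by rewrite normc0.
by rewrite (le_trans (le_normcD _ _))// lerD2l.
Qed.

Definition expc z : R[i] :=
  (expR (complex.Re z) * cos (complex.Im z)) +i*
  (expR (complex.Re z) * sin (complex.Im z)).

Lemma expcD z w : expc (z + w) = expc z * expc w.
Proof.
case: z w => [a b] [c d]; rewrite /expc/= expRD cosD sinD; apply/eqP.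
by rewrite eq_complex /=; apply/andP; split; apply/eqP; ring.
Qed.

Lemma expc0 : expc 0 = 1.
Proof. by rewrite /expc/= expR0 cos0 sin0 mul1r mulr0. Qed.

Lemma normc_expc z : normc (expc z) = expR (complex.Re z).
Proof.
case: z => a b; rewrite /= !exprMn -mulrDr cos2Dsin2 mulr1 sqrtr_sqr ger0_norm// expR_ge0.
Qed.

Lemma expc_neq0 z : expc z != 0.
Proof. by rewrite -normc_eq0 normc_expc gt_eqF// expR_gt0. Qed.

Lemma expcMn z n : expc (z *+ n) = expc z ^+ n.
Proof. by elim: n => [|n ih]; rewrite ?mulr0n ?expc0// mulrS expcD ih exprS. Qed.

(** Polar coordinates: [ln] of the modulus, and an argument obtained from [acos]. *)
Lemma expc_surj z : z != 0 -> exists w, expc w = z.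
Proof.
move=> z0; have n0 : 0 < normc z.
  by rewrite lt_neqAle normc_ge0 eq_sym normc_eq0 z0.
have n0' : normc z != 0 by rewrite gt_eqF.
case: z z0 n0 n0' => a b z0; set r := normc (a +i* b) => n0 n0'.
have rE : r ^+ 2 = a ^+ 2 + b ^+ 2.
  by rewrite sqr_sqrtr// addr_ge0 ?sqr_ge0.
have ar : -1 <= a / r <= 1.
  rewrite -ler_norml normrM normfV (gtr0_norm n0) ler_pdivrMr// mul1r.
  exact: (normc_Re (a +i* b)).
(* [acos] only covers the closed upper half-plane, so the sign of [b] decides the sign of the
   argument. *)
pose t := if 0 <= b then acos (a / r) else - acos (a / r).
have ct : cos t = a / r.
  by rewrite /t; case: ifP => _; rewrite ?cosN acosK// in_itv/=.
have st : sin t = b / r.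
  have bE : Num.sqrt (1 - (a / r) ^+ 2) = `|b| / r.
    rewrite (_ : 1 - _ = (b / r) ^+ 2).
      by rewrite sqrtr_sqr normrM normfV (gtr0_norm n0).
    rewrite !expr_div_n rE -[X in X - _](@divff _ (r ^+ 2)) ?expf_neq0// rE.
    by rewrite -mulrBl addrAC subrr add0r.
  rewrite /t; case: ifPn => [b0|/negP]; first by rewrite sin_acos// bE ger0_norm.
  move=> /negP; rewrite -ltNge => b0.
  by rewrite sinN sin_acos// bE ltr0_norm// mulNr opprK.
exists (ln r +i* t); rewrite /expc/= lnK ?posrE// ct st.
by rewrite !(mulrC r) !divfK.
Qed.

Lemma derive_eps (f : R -> R) c : is_derive (0 : R) (1 : R) f c ->
  forall e : R, 0 < e -> exists2 del : R, 0 < del &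
    forall h, `|h| < del -> `|f h - f 0 - c * h| <= e * `|h|.
Proof.
move=> [df dfc] e e0.
have : h^-1 *: ((f \o shift 0) h%:A - f 0) @[h --> 0^'] --> c.
  by rewrite -dfc; exact: df.
move=> /cvgrPdist_le /(_ _ e0)[del /= del0 H]; exists del => // h hd.
have [->|h0] := eqVneq h 0.
  by rewrite mulr0 subr0 subrr normr0 mulr0.
have := H h; rewrite /ball_/= sub0r normrN => /(_ hd h0).
rewrite /= scaler1 addr0 => {}H.
have -> : f h - f 0 - c * h = - (c - h^-1 *: (f h - f 0)) * h.
  by rewrite opprB mulrBl /GRing.scale/= mulrAC mulVf// mul1r.
by rewrite normrM normrN ler_wpM2r.
Qed.

Lemma expc_derive0 (e : R) : 0 < e -> exists2 del : R, 0 < del &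
  forall h, normc h < del -> normc (expc h - 1 - h) <= e * normc h.
Proof.
(* The final bound is 9 * [e1] * [r], with [r] the modulus of the increment; [e1 <= e / 16] leaves a
   margin and [e1 <= 1] absorbs the quadratic errors. *)
move=> e0; have [e1 [e10 e11 e1e]] : exists e1 : R, [/\ 0 < e1, e1 <= 1 & e1 <= e / 16].
  by exists (Num.min 1 (e / 16)); rewrite lt_min !ge_min !lexx ltr01 divr_gt0// orbT.
have [d1 d10 H1] := derive_eps (is_derive_expR (0 : R)) e10.
have [d2 d20 H2] := derive_eps (is_derive_cos (0 : R)) e10.
have [d3 d30 H3] := derive_eps (is_derive_sin (0 : R)) e10.
exists (Num.min (Num.min d1 d2) (Num.min d3 e1)).
  by rewrite !lt_min d10 d20 d30 e10.
move=> [x y] h; have := normc_Re (x +i* y); have := normc_Im (x +i* y).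
move: h; set r := normc _; rewrite !lt_min => /andP[/andP[r1 r2] /andP[r3 r4]].
move=> yr xr; have r0 : 0 <= r by exact: normc_ge0.
have {H1} := H1 x (le_lt_trans xr r1); rewrite expR0 mul1r.
have {H2} := H2 y (le_lt_trans yr r2); rewrite cos0 sin0 oppr0 mul0r subr0.
have {H3} := H3 y (le_lt_trans yr r3); rewrite cos0 sin0 subr0 mul1r.
set a := expR x - 1 - x; set b := cos y - 1; set c := sin y - y => Hc Hb Ha.
have cr : `|c| <= e1 * r by rewrite (le_trans Hc)// ler_pM2l.
have br : `|b| <= e1 * r by rewrite (le_trans Hb)// ler_pM2l.
have ar : `|a| <= e1 * r by rewrite (le_trans Ha)// ler_pM2l.
have er1 : e1 * r <= r by rewrite ler_piMl.
rewrite (_ : expc _ - 1 - _ = (expR x * cos y - 1 - x) +i* (expR x * sin y - 0 - y)) //.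
apply: (le_trans (normc_le_ReIm (_ +i* _))); rewrite [complex.Re _]/= [complex.Im _]/=.
have -> : expR x * cos y - 1 - x = a + b * (1 + x + a).
  by rewrite /a /b; ring.
have -> : expR x * sin y - 0 - y = c + (x + a) * (y + c).
  by rewrite /a /c; ring.
have A1 : `|1 + x + a| <= 3.
  rewrite (le_trans (ler_normD _ _))// (le_trans (lerD (ler_normD _ _) (lexx _)))//.
  rewrite normr1; lra.
have A2 : `|x + a| <= 2 * e1.
  rewrite (le_trans (ler_normD _ _))//; lra.
have A3 : `|y + c| <= 2 * r.
  rewrite (le_trans (ler_normD _ _))//; lra.
apply: (@le_trans _ _ (e1 * r + e1 * r * 3 + (e1 * r + 2 * e1 * (2 * r)))).
  apply: lerD; rewrite (le_trans (ler_normD _ _))// lerD// normrM ler_pM//.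
have : e1 * r <= e / 16 * r by rewrite ler_wpM2r.
have : 0 <= e * r by rewrite mulr_ge0// ltW.
lra.
Qed.

Definition cis (t : R) : R[i] := expc (0 +i* t).

Lemma cisE t : cis t = cos t +i* sin t.
Proof. by rewrite /cis /expc/= expR0 !mul1r. Qed.

Lemma cisD s t : cis (s + t) = cis s * cis t.
Proof. by rewrite -expcD; congr expc; rewrite -[RHS]/((0 + 0) +i* (s + t)) addr0. Qed.

Lemma cis0 : cis 0 = 1.
Proof. exact: expc0. Qed.

Lemma cisMn t n : cis (t *+ n) = cis t ^+ n.
Proof. by elim: n => [|n ih]; rewrite ?mulr0n ?cis0// mulrS cisD ih exprS. Qed.

Lemma normc_cis t : normc (cis t) = 1.
Proof. by rewrite normc_expc expR0. Qed.

(** If cos t = 1, the half-angle formula gives sin (t / 2) = 0, impossible for t / 2 strictly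
    between 0 and pi. *)
Lemma cis_neq1 t : 0 < t < pi *+ 2 -> cis t != 1.
Proof.
move=> /andP[t0 tp]; rewrite cisE; apply/eqP => -[ct _].
have : sin (t / 2) > 0.
  by rewrite sin_gt0_pi// divr_gt0//= ltr_pdivrMr// mulr_natr.
have : sin (t / 2) ^+ 2 = 0.
  have := cos_mulr2n (t / 2); rewrite -[t / 2 *+ 2]mulr_natr divfK// ct cos2sin2.
  rewrite mulr2n; lra.
by move=> /eqP; rewrite expf_eq0 /= => /eqP ->; rewrite ltxx.
Qed.

Definition unity (n : nat) : R[i] := cis (pi *+ 2 / n%:R).

Lemma normc_unityX n k : normc (unity n ^+ k) = 1.
Proof. by rewrite normcX normc_cis expr1n. Qed.

Lemma unityX_neq0 n k : unity n ^+ k != 0.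
Proof. by rewrite -normc_eq0 normc_unityX oner_neq0. Qed.

Lemma unityXn n : (0 < n)%N -> unity n ^+ n = 1.
Proof.
move=> n0; rewrite -cisMn -(mulr_natr (_ / _)) divfK ?pnatr_eq0 -?lt0n// cisE.
by rewrite cos2pi sin2pi.
Qed.

Lemma unityX_neq1 n k : (0 < k < n)%N -> unity n ^+ k != 1.
Proof.
move=> /andP[k0 kn]; rewrite -cisMn; apply: cis_neq1.
have n0 : (0 : R) < n%:R by rewrite ltr0n (leq_ltn_trans _ kn).
have p0 : (0 : R) < pi *+ 2 by rewrite mulrn_wgt0// pi_gt0.
rewrite -(mulr_natr (_ / _)); apply/andP; split.
  by rewrite mulr_gt0 ?divr_gt0// ltr0n.
by rewrite mulrAC ltr_pdivrMr// ltr_pM2l// ltr_nat.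
Qed.

Lemma unity_sumX n l : (0 < l < n)%N ->
  \sum_(0 <= k < n) (unity n ^+ k) ^+ l = 0.
Proof.
move=> /andP[l0 ln]; have n0 := leq_trans l0 (ltnW ln).
have : (unity n ^+ l - 1) * (\sum_(0 <= k < n) (unity n ^+ k) ^+ l) = 0.
  rewrite big_mkord (eq_bigr (fun i : 'I_n => (unity n ^+ l) ^+ i)) => [|i _].
    by rewrite -subrX1 exprAC unityXn// expr1n subrr.
  by rewrite exprAC.
move/eqP; rewrite mulf_eq0 subr_eq0 => /orP[|/eqP//].
by rewrite (negbTE (@unityX_neq1 _ _ _))// l0.
Qed.

(** On n-th roots of unity x^-l equals x^(n - l), which leads back to [unity_sumX]. *)
Lemma unity_sumV n l : (0 < l < n)%N ->
  \sum_(0 <= k < n) (unity n ^+ k) ^- l = 0.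
Proof.
move=> /andP[l0 ln]; have n0 := leq_trans l0 (ltnW ln).
rewrite -[RHS](@unity_sumX n (n - l)); last by rewrite subn_gt0 ln ltn_subrL l0 n0.
apply: eq_bigr => k _.
have xl0 : unity n ^+ k ^+ l != 0 by rewrite expf_neq0// unityX_neq0.
apply: (@mulIf _ (unity n ^+ k ^+ l)) => //.
rewrite -(exprD (unity n ^+ k)) subnK ?(ltnW ln)//.
by rewrite (mulVf xl0) [RHS]exprAC unityXn// expr1n.
Qed.

End complex_exponential.

(** * Real-valued norm on [Y] and convergence of sequences *)

Section rnorm_theory.
Context {R : realType} {Y : completeNormedModType R[i]}.
Implicit Types (x y z : Y) (a : R[i]).

Lemma rnormE y : `|y| = (rnorm y)%:C.
Proof.
rewrite /rnorm; have := normr_ge0 y; case: `|y| => a b /=.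
by rewrite lecE/= => /andP[/eqP -> _].
Qed.

Lemma rnorm_ge0 y : 0 <= rnorm y.
Proof. by rewrite -lecR -rnormE normr_ge0. Qed.

Lemma rnorm0 : rnorm (0 : Y) = 0.
Proof. by rewrite /rnorm normr0. Qed.

Lemma rnormN y : rnorm (- y) = rnorm y.
Proof. by rewrite /rnorm normrN. Qed.

Lemma rnorm_distC x y : rnorm (x - y) = rnorm (y - x).
Proof. by rewrite -opprB rnormN. Qed.

Lemma rnormD x y : rnorm (x + y) <= rnorm x + rnorm y.
Proof. by rewrite -lecR rmorphD/= -!rnormE ler_normD. Qed.

Lemma rnormB x y : rnorm (x - y) <= rnorm x + rnorm y.
Proof. by rewrite -(rnormN y) rnormD. Qed.

Lemma rnorm_distD y x z : rnorm (x - z) <= rnorm (x - y) + rnorm (y - z).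
Proof. by rewrite (le_trans _ (rnormD _ _))// subrKA. Qed.

Lemma rnorm_le_dist x y : rnorm x <= rnorm y + rnorm (x - y).
Proof. by rewrite (le_trans _ (rnormD _ _))// addrC subrK. Qed.

Lemma rnormZ a y : rnorm (a *: y) = normc a * rnorm y.
Proof. by apply: complexI; rewrite rmorphM/= -!rnormE normrZ normcE. Qed.

Lemma rnorm_sum (I : Type) (s : seq I) (F : I -> Y) :
  rnorm (\sum_(i <- s) F i) <= \sum_(i <- s) rnorm (F i).
Proof.
elim/big_rec2: _ => [|i y x _ ih]; first by rewrite rnorm0.
by rewrite (le_trans (rnormD _ _))// lerD2l.
Qed.

(** The norm of [Y] takes values in [R[i]], while the estimates below compare real numbers; hence a
    notion of convergence with real epsilons, which [tendsP] links to the filter one. *)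
Definition tends (u : nat -> Y) (l : Y) := forall e : R, 0 < e ->
  \forall n \near \oo, rnorm (u n - l) < e.

Lemma tendsP u l : tends u l <-> u @ \oo --> l.
Proof.
split=> [ul|/cvgrPdist_lt ul e e0].
  apply/cvgrPdist_lt => e; rewrite ltcE/= => /andP[/eqP ei e0].
  apply: filterS (ul _ e0) => n; rewrite rnorm_distC rnormE.
  by rewrite ltcE/= ei eqxx.
have := ul e%:C; rewrite ltcR => /(_ e0); apply: filterS => n.
by rewrite rnormE ltcR rnorm_distC.
Qed.

Lemma tends_unique u l l' : tends u l -> tends u l' -> l = l'.
Proof.
by move=> /tendsP ul /tendsP ul'; apply: cvg_unique ul ul'; exact: norm_hausdorff.
Qed.

Lemma tends_cauchy (u : nat -> Y) :
  (forall e : R, 0 < e -> exists N, forall m n, (N <= m)%N -> (N <= n)%N ->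
    rnorm (u m - u n) < e) -> tends u (lim (u @ \oo)).
Proof.
move=> H; apply/tendsP; apply/cauchy_cvgP.
apply/cauchy_ballP => e; rewrite ltcE/= => /andP[/eqP ei e0].
have [N HN] := H _ e0.
exists (u @` [set n | (N <= n)%N], u @` [set n | (N <= n)%N]) => /=.
  by split; exists N => // n Nn; exists n.
move=> [_ _] [/= [m Nm <-] [n Nn <-]]; rewrite -ball_normE/ball_/=.
by rewrite rnormE ltcE/= ei eqxx HN.
Qed.

Lemma tendsD u v l k : tends u l -> tends v k -> tends (fun n => u n + v n) (l + k).
Proof. by move=> /tendsP ul /tendsP vk; apply/tendsP; exact: cvgD. Qed.

Lemma tendsN u l : tends u l -> tends (fun n => - u n) (- l).
Proof. by move=> /tendsP ul; apply/tendsP; exact: cvgN. Qed.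

Lemma tendsB u v l k : tends u l -> tends v k -> tends (fun n => u n - v n) (l - k).
Proof. by move=> ul vk; apply: tendsD => //; exact: tendsN. Qed.

Lemma tendsZ a u l : tends u l -> tends (fun n => a *: u n) (a *: l).
Proof.
move=> ul e e0; have b0 : 0 < normc a + 1 by rewrite ltr_wpDl// normc_ge0.
have := ul (e / (normc a + 1)); rewrite divr_gt0// => /(_ isT).
apply: filterS => n; rewrite -scalerBr rnormZ ltr_pdivlMr// mulrC => ue.
by rewrite (le_lt_trans _ ue)// ler_wpM2r ?rnorm_ge0// lerDl.
Qed.

Lemma tends_sum (I : Type) (s : seq I) (F : I -> nat -> Y) (l : I -> Y) :
  (forall i, tends (F i) (l i)) ->
  tends (fun n => \sum_(i <- s) F i n) (\sum_(i <- s) l i).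
Proof.
move=> H; elim: s => [|i s ih].
  by move=> e e0; near=> n; rewrite !big_nil subr0 rnorm0.
move=> e e0; have := tendsD (H i) ih e0; apply: filterS => n.
by rewrite !big_cons.
Unshelve. all: by end_near. Qed.

Lemma tends_shift n u l : tends u l -> tends (fun N => u (N + n)%N) l.
Proof.
move=> ul e e0; have [N0 _ H] := ul e e0; exists N0 => // N /= NN.
by apply: H; rewrite /= (leq_trans NN)// leq_addr.
Qed.

Lemma tends_eq u v l : (\forall n \near \oo, u n = v n) -> tends u l -> tends v l.
Proof. by move=> uv ul e e0; apply: filterS2 uv (ul _ e0) => n ->. Qed.

Lemma tends_le u l (b : R) : tends u l ->
  (\forall n \near \oo, rnorm (u n) <= b) -> rnorm l <= b.
Proof.
move=> ul ub; rewrite leNgt; apply/negP => bl.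
have := ul (rnorm l - b); rewrite subr_gt0 => /(_ bl) H.
have [n [n1 n2]] := filter_ex (filterI H ub).
have := rnorm_le_dist l (u n); rewrite leNgt rnorm_distC => /negP; apply.
by rewrite -ltrBDl (lt_le_trans n1)// lerB.
Qed.

End rnorm_theory.

(** * Goursat's theorem for dyadic Riemann sums *)

Section goursat.
Context {R : realType} {Y : completeNormedModType R[i]}.
Implicit Types (g : R[i] -> Y) (w u v : R[i]).

Definition cdiff g := forall w, exists L : Y, forall e : R, 0 < e ->
  exists2 del : R, 0 < del & forall h, normc h < del ->
    rnorm (g (w + h) - g w - h *: L) <= e * normc h.

Definition seg_mean n g w u : Y :=
  (2 ^- n) *: \sum_(0 <= k < 2 ^ n) g (w + k%:R / 2 ^+ n * u).

(* A left Riemann sum of [g] around the parallelogram [w], [w + u], [w + u + v],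
   [w + v]: it is additive under dyadic subdivision and vanishes on affine [g]. *)
Definition circulation n g w u v : Y :=
  u *: (seg_mean n g w u - seg_mean n g (w + v) u) +
  v *: (seg_mean n g (w + u) v - seg_mean n g w v).

(** Doubling both the segment and the number of points keeps the step u / 2^n, so the left sums of
    the two halves join without error term. *)
Lemma seg_meanS n g w u : seg_mean n.+1 g w (u + u) =
  2^-1 *: (seg_mean n g w u + seg_mean n g (w + u) u).
Proof.
have n0 : (2 : R[i]) ^+ n != 0 by rewrite expf_neq0// pnatr_eq0.
rewrite /seg_mean expnS mul2n -addnn.
rewrite (@big_cat_nat _ _ _ (2 ^ n)%N) ?leq_addr//=.
have E (F : nat -> Y) : \sum_(2 ^ n <= i < 2 ^ n + 2 ^ n) F i =
    \sum_(0 <= i < 2 ^ n) F (i + 2 ^ n)%N.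
  by rewrite -{1}[(2 ^ n)%N]add0n big_addn addnK.
rewrite E -scalerDr scalerA; congr (_ *: (_ + _)).
- by rewrite -invfM exprS.
- by apply: eq_bigr => k _; congr (g (w + _)); rewrite exprS; field.
- by apply: eq_bigr => k _; congr (g _); rewrite natrD natrX exprS; field.
Qed.

Lemma seg_meanB n g g' w u :
  seg_mean n (fun z => g z - g' z) w u = seg_mean n g w u - seg_mean n g' w u.
Proof. by rewrite /seg_mean sumrB scalerBr. Qed.

Lemma seg_mean_le n g w u (b : R) :
  (forall t : R, 0 <= t <= 1 -> rnorm (g (w + t%:C * u)) <= b) ->
  rnorm (seg_mean n g w u) <= b.
Proof.
move=> gb; rewrite /seg_mean rnormZ.
have n0 : (0 : R) < 2 ^+ n by rewrite exprn_gt0.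
have -> : normc (2 ^- n : R[i]) = 2 ^- n.
  by rewrite normcV normcX -[2]/(2%:R) -(rmorph_nat (real_complex R)) normcR ger0_norm.
rewrite ler_pdivrMl// (le_trans (rnorm_sum _ _))//.
rewrite (_ : _ * b = \sum_(0 <= k < 2 ^ n) b); last first.
  by rewrite sumr_const_nat subn0 -[RHS]mulr_natl natrX.
rewrite big_nat [leRHS]big_nat; apply: ler_sum => k /andP[_ kn].
have -> : k%:R / 2 ^+ n = (k%:R / 2 ^+ n : R)%:C.
  by rewrite rmorphM/= fmorphV rmorphXn/= !rmorph_nat.
apply: gb; rewrite divr_ge0 ?ler0n ?(ltW n0)//= ler_pdivrMr// mul1r.
by rewrite -natrX ler_nat ltnW.
Qed.

(** Each inner edge of the subdivision in four is traversed twice, in opposite directions. *)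
Lemma circulationS n g w u v : circulation n.+1 g w (u + u) (v + v) =
  circulation n g w u v + circulation n g (w + u) u v +
  (circulation n g (w + v) u v + circulation n g (w + u + v) u v).
Proof.
have half (x : R[i]) (p q r s : Y) : (x + x) *: (2^-1 *: (p + q) - 2^-1 *: (r + s)) =
    x *: (p - r) + x *: (q - s).
  rewrite -scalerBr scalerA (_ : (x + x) / 2 = x); last by field.
  by rewrite opprD addrACA scalerDr.
rewrite /circulation !seg_meanS !half// !addrA.
rewrite (_ : w + u + v + u = w + u + u + v); last by ring.
rewrite (_ : w + u + v + v = w + v + v + u); last by ring.
rewrite (_ : w + v + u = w + u + v); last by ring.
set y1 := seg_mean n g w u; set y2 := seg_mean n g (w + u) u.
set y3 := seg_mean n g (w + v + v) u; set y4 := seg_mean n g (w + v + v + u) u.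
set c1 := seg_mean n g (w + v) u; set c2 := seg_mean n g (w + u + v) u.
set x1 := seg_mean n g (w + u + u) v; set x2 := seg_mean n g (w + u + u + v) v.
set x3 := seg_mean n g w v; set x4 := seg_mean n g (w + v) v.
set d1 := seg_mean n g (w + u) v; set d2 := seg_mean n g (w + u + v) v.
(* Opposite outer edges are compared through the inner edges [c1], [c2], [d1], [d2]; the two sides
   then differ by a permutation of eight terms. *)
rewrite -(subrKA c1 y1 (- y3)) -(subrKA c2 y2 (- y4)) -(subrKA d1 x1 (- x3)).
rewrite -(subrKA d2 x2 (- x4)) (scalerDr u (y1 - c1)) (scalerDr u (y2 - c2)).
rewrite (scalerDr v (x1 - d1)) (scalerDr v (x2 - d2)) !addrA.
by rewrite [LHS](ACl (1*6*3*5*2*8*4*7))/=.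
Qed.

Lemma circulationB n g g' w u v : circulation n (fun z => g z - g' z) w u v =
  circulation n g w u v - circulation n g' w u v.
Proof.
have D4 (a b c d : Y) : (a - b) - (c - d) = (a - c) - (b - d).
  by rewrite opprD addrACA -opprD.
rewrite /circulation !seg_meanB (D4 (seg_mean n g w u)) (D4 (seg_mean n g (w + u) v)).
rewrite scalerBr [X in _ + X]scalerBr.
by rewrite addrACA -opprD.
Qed.

(** The mean of an affine function over any segment is its value at w + c u, with the same [c] for
    all segments. The value of [c], which is not 1/2, cancels: what remains is v u - u v. *)
Lemma circulation_affine n (a L : Y) w u v :
  circulation n (fun z => a + z *: L) w u v = 0.
Proof.
pose c : R[i] := 2 ^- n * \sum_(0 <= k < 2 ^ n) (k%:R / 2 ^+ n).
have E w' u' : seg_mean n (fun z => a + z *: L) w' u' = a + (w' + c * u') *: L.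
  rewrite /seg_mean big_split/= scalerDr sumr_const_nat subn0 -scalerMnr.
  rewrite -scaler_nat scalerA natrX mulfV ?expf_neq0 ?pnatr_eq0// scale1r.
  rewrite -scaler_suml scalerA big_split/= sumr_const_nat subn0 mulrDr.
  rewrite -mulr_suml mulrA -[w' *+ _]mulr_natl natrX mulrA mulVf; last first.
    by rewrite expf_neq0// pnatr_eq0.
  by rewrite mul1r.
rewrite /circulation !E.
have D (x1 x2 : R[i]) : a + x1 *: L - (a + x2 *: L) = (x1 - x2) *: L.
  by rewrite opprD addrACA subrr add0r scalerBl.
rewrite !D !scalerA -scalerDl (_ : _ + _ = 0) ?scale0r//; ring.
Qed.

(** By [circulation_affine] the affine function can be subtracted at no cost; each of the four sides
    then has a mean of norm at most [b]. *)
Lemma circulation_le n g (a L : Y) w u v (b : R) :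
  (forall s t : R, 0 <= s <= 1 -> 0 <= t <= 1 ->
     rnorm (g (w + s%:C * u + t%:C * v) - (a + (w + s%:C * u + t%:C * v) *: L)) <= b) ->
  rnorm (circulation n g w u v) <= 2 * b * (normc u + normc v).
Proof.
move=> H; rewrite -[circulation _ _ _ _ _]subr0 -(circulation_affine n a L w u v).
rewrite -circulationB; set h := fun z => _.
have H' (s t : R) : 0 <= s <= 1 -> 0 <= t <= 1 ->
  rnorm (h (w + s%:C * u + t%:C * v)) <= b by exact: H.
have c0 : (0 : R) <= (0 : R) <= (1 : R) by rewrite lexx ler01.
have c1 : (0 : R) <= (1 : R) <= (1 : R) by rewrite lexx ler01.
have C0 : (0 : R)%:C = 0 by [].
have C1 : (1 : R)%:C = 1 by [].
have S1 : rnorm (seg_mean n h w u) <= b.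
  by apply: seg_mean_le => t t01; have := H' t 0 t01 c0; rewrite C0 mul0r addr0.
have S2 : rnorm (seg_mean n h (w + v) u) <= b.
  by apply: seg_mean_le => t t01; have := H' t 1 t01 c1; rewrite C1 mul1r addrAC.
have S3 : rnorm (seg_mean n h (w + u) v) <= b.
  by apply: seg_mean_le => t t01; have := H' 1 t c1 t01; rewrite C1 mul1r.
have S4 : rnorm (seg_mean n h w v) <= b.
  by apply: seg_mean_le => t t01; have := H' 0 t c0 t01; rewrite C0 mul0r addr0.
rewrite /circulation (le_trans (rnormD _ _))// !rnormZ mulrDr.
by apply: lerD; rewrite mulrC ler_wpM2r ?normc_ge0// (le_trans (rnormB _ _))//
  mulr_natl mulr2n lerD.
Qed.

Lemma nested_limit (s : nat -> R) :
  (forall k, s k <= s k.+1 <= s k + 2 ^- k.+1) ->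
  exists l, forall k, s k <= l <= s k + 2 ^- k.
Proof.
move=> H.
have mono k j : s k <= s (k + j)%N.
  elim: j => [|j ih]; first by rewrite addn0.
  by rewrite addnS (le_trans ih)//; case/andP: (H (k + j)%N).
have up k j : s (k + j)%N <= s k + 2 ^- k - 2 ^- (k + j).
  elim: j => [|j ih]; first by rewrite addn0 addrK.
  have /andP[_] := H (k + j)%N; rewrite addnS => /le_trans; apply.
  have -> : (2 ^- (k + j).+1 : R) = 2 ^- (k + j) / 2.
    by rewrite exprS invfM mulrC.
  move: ih; lra.
have ub k : ubound (range s) (s k + 2 ^- k).
  move=> _ [j _ <-]; have [kj|jk] := leqP k j.
    rewrite -(subnKC kj) (le_trans (up _ _))// lerBlDr lerDl invr_ge0.
    by rewrite exprn_ge0.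
  apply: (le_trans (mono j (k - j)%N)); rewrite subnKC; last exact: ltnW.
  by rewrite lerDl invr_ge0 exprn_ge0.
have hs : has_sup (range s) by split; [exists (s 0%N), 0%N | exists (s 0%N + 2 ^- 0)].
exists (sup (range s)) => k; apply/andP; split.
  by apply: ub_le_sup; [case: hs|exists k].
by apply: ge_sup => //; case: hs.
Qed.

(** Bisection, where a parallelogram of generation k is bad if its circulations do not stay below e
    / 4^k for all large n. A bad one has a bad quarter. Near the common limit point
    differentiability makes the circulation small compared with the square of the size, against
    badness. *)
Lemma goursat g w u v (e : R) : cdiff g -> 0 < e ->
  exists N, forall n, (N <= n)%N -> rnorm (circulation n g w u v) < e.
Proof.
move=> dg e0; apply: contrapT => bad0.
pose half k (x : R[i]) : R[i] := (2 ^- k : R)%:C * x.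
pose pt (p : R * R) := w + p.1%:C * u + p.2%:C * v.
pose bad k p := ~ exists N, forall n, (N <= n)%N ->
  rnorm (circulation n g (pt p) (half k u) (half k v)) < e / 4 ^+ k.
have halfS k x : half k x = half k.+1 x + half k.+1 x.
  rewrite /half -mulrDl -rmorphD/=; congr (_%:C * _).
  by rewrite exprS invfM -mulrDl; lra.
have step kp : exists q, bad kp.1 kp.2 -> bad kp.1.+1 q /\
    (kp.2.1 <= q.1 <= kp.2.1 + 2 ^- kp.1.+1) /\
    (kp.2.2 <= q.2 <= kp.2.2 + 2 ^- kp.1.+1).
  case: kp => k [s t] /=; apply: contrapT => /forallNP nbad.
  have c0 : (0 : R) <= 2 ^- k.+1 by rewrite invr_ge0 exprn_ge0.
  have good a b : s <= a <= s + 2 ^- k.+1 -> t <= b <= t + 2 ^- k.+1 ->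
      bad k (s, t) /\ ~ bad k.+1 (a, b).
    move=> ha hb; have /not_implyP[bk nb] := nbad (a, b).
    by split=> // bab; apply: nb.
  have i0 (x : R) : x <= x <= x + 2 ^- k.+1 by rewrite lexx lerDl.
  have i1 (x : R) : x <= x + 2 ^- k.+1 <= x + 2 ^- k.+1 by rewrite lexx lerDl c0.
  have [bk /contrapT[N1 H1]] := good s t (i0 s) (i0 t).
  have [_ /contrapT[N2 H2]] := good _ t (i1 s) (i0 t).
  have [_ /contrapT[N3 H3]] := good s _ (i0 s) (i1 t).
  have [_ /contrapT[N4 H4]] := good _ _ (i1 s) (i1 t).
  (* If the four quarters were good, so would be the parent: its circulation at level [n.+1] is the
     sum of theirs at level [n], whence the successor in the threshold. *)
  apply: bk; exists (N1 + N2 + N3 + N4).+1 => -[//|n] Nn.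
  rewrite (halfS k u) (halfS k v) circulationS.
  have := H1 n; have := H2 n; have := H3 n; have := H4 n.
  move=> /(_ ltac:(lia)) E4 /(_ ltac:(lia)) E3 /(_ ltac:(lia)) E2 /(_ ltac:(lia)) E1.
  rewrite (le_lt_trans (rnormD _ _))//.
  rewrite (le_lt_trans (lerD (rnormD _ _) (rnormD _ _)))//.
  have p2 : pt (s + 2 ^- k.+1, t) = pt (s, t) + half k.+1 u.
    by rewrite /pt /half /= rmorphD/=; ring.
  have p3 : pt (s, t + 2 ^- k.+1) = pt (s, t) + half k.+1 v.
    by rewrite /pt /half /= rmorphD/=; ring.
  have p4 : pt (s + 2 ^- k.+1, t + 2 ^- k.+1) = pt (s, t) + half k.+1 u + half k.+1 v.
    by rewrite /pt /half /= !rmorphD/=; ring.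
  rewrite p2 in E2; rewrite p3 in E3; rewrite p4 in E4.
  have e4 : e / 4 ^+ k =
      (e / 4 ^+ k.+1 + e / 4 ^+ k.+1) + (e / 4 ^+ k.+1 + e / 4 ^+ k.+1).
    by rewrite exprS; field; rewrite expf_neq0.
  by rewrite e4; apply: ltrD; apply: ltrD.
have [F HF] := choice step.
pose p := fix p k : R * R := if k is j.+1 then F (j, p j) else (0, 0).
have badp k : bad k (p k).
  elim: k => [|k ih]; last by have [] := HF (k, p k) ih.
  have h0 x : half 0%N x = x by rewrite /half expr0 invr1 mul1r.
  rewrite /bad !h0 expr0 divr1 (_ : pt _ = w).
    exact: bad0.
  by rewrite /pt/= !mul0r !addr0.
have [sl Hs] : exists l, forall k, (p k).1 <= l <= (p k).1 + 2 ^- k.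
  by apply: nested_limit => k; have [_ []] := HF (k, p k) (badp k).
have [tl Ht] : exists l, forall k, (p k).2 <= l <= (p k).2 + 2 ^- k.
  by apply: nested_limit => k; have [_ []] := HF (k, p k) (badp k).
pose rho := normc u + normc v.
have rho0 : 0 <= rho by rewrite addr_ge0 ?normc_ge0.
(* [circulation_le] will give at most 2 c (rho / 2^k)^2, which must be below e / 4^k; the [+ 1]
   covers [rho = 0] and makes the inequality strict. *)
pose c := e / (2 * rho ^+ 2 + 1).
have den0 : 0 < 2 * rho ^+ 2 + 1.
  by rewrite ltr_wpDl// mulr_ge0// exprn_ge0.
have c0 : 0 < c by rewrite divr_gt0.
set ws := pt (sl, tl).
have [L /(_ _ c0)[del del0 HL]] := dg ws.
have [k Hk] : exists k, 2 ^- k * rho < del.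
  have [k Hk] : exists k, rho / del < 2 ^+ k.
    by exists (Num.bound (rho / del)); exact: upper_nthrootP.
  exists k; rewrite mulrC ltr_pdivrMr ?exprn_gt0//.
  by rewrite -ltr_pdivrMl// mulrC.
apply: (badp k); exists 0%N => n _.
have hk0 : (0 : R) < 2 ^- k by rewrite invr_gt0 exprn_gt0.
have nhalf x : normc (half k x) = 2 ^- k * normc x.
  by rewrite normcM normcR gtr0_norm.
have B s t : 0 <= s <= 1 -> 0 <= t <= 1 ->
  rnorm (g (pt (p k) + s%:C * half k u + t%:C * half k v) -
   ((g ws - ws *: L) + (pt (p k) + s%:C * half k u + t%:C * half k v) *: L))
    <= c * (2 ^- k * rho).
  move=> s01 t01; set z := pt (p k) + _ + _.
  have zw : z - ws = ((p k).1 + s * 2 ^- k - sl)%:C * u +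
                     ((p k).2 + t * 2 ^- k - tl)%:C * v.
    rewrite /z /ws /pt /half !rmorphB !rmorphD !rmorphM/=; ring.
  have small (a x l : R) : 0 <= a <= 1 -> x <= l <= x + 2 ^- k ->
      `|x + a * 2 ^- k - l| <= 2 ^- k.
    move=> /andP[a0 a1] /andP[l0 l1]; rewrite ler_norml.
    have : a * 2 ^- k <= 1 * 2 ^- k by rewrite ler_wpM2r// ltW.
    have : 0 <= a * 2 ^- k by rewrite mulr_ge0// ltW.
    rewrite mul1r => *; apply/andP; split; lra.
  have zwn : normc (z - ws) <= 2 ^- k * rho.
    rewrite zw (le_trans (le_normcD _ _))// !normcM !normcR mulrDr.
    by apply: lerD; apply: ler_wpM2r; rewrite ?normc_ge0// small.
  have := HL (z - ws) (le_lt_trans zwn Hk); rewrite [ws + _]addrC subrK => HLz.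
  rewrite (_ : g z - _ = g z - g ws - (z - ws) *: L).
    by rewrite (le_trans HLz)// ler_wpM2l// ltW.
  by rewrite scalerBl !opprD !opprK !addrA addrAC.
rewrite (le_lt_trans (circulation_le n B))// !nhalf -mulrDr -/rho.
rewrite ltr_pdivlMr ?exprn_gt0//.
have -> : (4 : R) ^+ k = 2 ^+ k * 2 ^+ k by rewrite -exprMn; congr (_ ^+ _); lra.
have -> : 2 * (c * (2 ^- k * rho)) * (2 ^- k * rho) * (2 ^+ k * 2 ^+ k) =
    c * (2 * rho ^+ 2) by field; rewrite expf_neq0.
by rewrite /c mulrAC ltr_pdivrMr// ltr_pM2l// ltrDl.
Qed.

End goursat.

(** * Means over circles: independence of the radius and mean value property *)

Section circle_means.
Context {R : realType} {Y : completeNormedModType R[i]}.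
Implicit Types (g : R[i] -> Y) (w u h : R[i]).

Definition scdiff (phi : R[i] -> R[i]) := forall w, exists c : R[i],
  forall e : R, 0 < e -> exists2 del : R, 0 < del & forall h, normc h < del ->
    normc (phi (w + h) - phi w - h * c) <= e * normc h.

Lemma scdiff_lip phi w : scdiff phi -> exists2 C : R, 0 < C &
  exists2 del : R, 0 < del & forall h, normc h < del ->
    normc (phi (w + h) - phi w) <= C * normc h.
Proof.
move=> /(_ w)[c /(_ 1 ltr01)[del del0 H]].
exists (normc c + 1); first by rewrite ltr_wpDl// normc_ge0.
exists del => // h hd; rewrite -[phi _ - _](subrK (h * c)).
by rewrite (le_trans (le_normcD _ _))// normcM mulrDl addrC lerD ?H// mulrC.
Qed.

Lemma cdiff_lip g w : cdiff g -> exists2 C : R, 0 < C &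
  exists2 del : R, 0 < del & forall h, normc h < del ->
    rnorm (g (w + h) - g w) <= C * normc h.
Proof.
move=> /(_ w)[L /(_ 1 ltr01)[del del0 H]].
exists (rnorm L + 1); first by rewrite ltr_wpDl// rnorm_ge0.
exists del => // h hd; rewrite -[g _ - _](subrK (h *: L)).
by rewrite (le_trans (rnormD _ _))// rnormZ mulrDl addrC lerD ?H// mulrC.
Qed.

Lemma cdiff_comp g phi : cdiff g -> scdiff phi -> cdiff (g \o phi).
Proof.
move=> dg dphi w; have [c Hc] := dphi w; have [L HL] := dg (phi w).
have [C C0 [d1 d10 H1]] := scdiff_lip w dphi.
exists (c *: L) => e e0.
pose e1 := e / 2 / C; pose e2 := e / 2 / (rnorm L + 1).
have L0 : 0 < rnorm L + 1 by rewrite ltr_wpDl// rnorm_ge0.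
have e10 : 0 < e1 by rewrite !divr_gt0.
have e20 : 0 < e2 by rewrite !divr_gt0.
have [d2 d20 H2] := HL _ e10; have [d3 d30 H3] := Hc _ e20.
exists (Num.min d1 (Num.min (d2 / C) d3)); first by rewrite !lt_min d10 divr_gt0.
move=> h; rewrite !lt_min => /and3P[hd1 hd2 hd3] /=.
set k := phi (w + h) - phi w.
have kC : normc k <= C * normc h by exact: H1.
have kd : normc k < d2 by rewrite (le_lt_trans kC)// mulrC -ltr_pdivlMr.
have -> : g (phi (w + h)) - g (phi w) - h *: (c *: L) =
    (g (phi w + k) - g (phi w) - k *: L) + (k - h * c) *: L.
  rewrite (_ : phi w + k = phi (w + h)); last by rewrite /k addrC subrK.
  by rewrite [(k - _) *: L]scalerBl scalerA [RHS]addrA subrK.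
rewrite (le_trans (rnormD _ _))//.
have -> : e * normc h = e / 2 * normc h + e / 2 * normc h by lra.
apply: lerD.
  rewrite (le_trans (H2 _ kd))// (le_trans (ler_wpM2l _ kC)) ?(ltW e10)//.
  by rewrite mulrA divfK ?gt_eqF.
rewrite rnormZ (le_trans (ler_wpM2r _ (H3 _ hd3))) ?rnorm_ge0// mulrAC.
rewrite ler_wpM2r ?normc_ge0// /e2 mulrAC ler_pdivrMr//.
by rewrite ler_wpM2l ?divr_ge0 ?(ltW e0)// lerDl.
Qed.

Lemma cdiff_scale g phi : cdiff g -> scdiff phi -> cdiff (fun w => phi w *: g w).
Proof.
move=> dg dphi w; have [c Hc] := dphi w; have [L HL] := dg w.
have [C C0 [d1 d10 H1]] := scdiff_lip w dphi.
exists (c *: g w + phi w *: L) => e e0.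
have G0 : 0 < rnorm (g w) + 1 by rewrite ltr_wpDl// rnorm_ge0.
have P0 : 0 < normc (phi w) + 1 by rewrite ltr_wpDl// normc_ge0.
have L0 : 0 < rnorm L + 1 by rewrite ltr_wpDl// rnorm_ge0.
have [d2 d20 H2] : exists2 d : R, 0 < d & forall h, normc h < d ->
    normc (phi (w + h) - phi w - h * c) <= e / 3 / (rnorm (g w) + 1) * normc h.
  by apply: Hc; rewrite !divr_gt0.
have [d3 d30 H3] : exists2 d : R, 0 < d & forall h, normc h < d ->
    rnorm (g (w + h) - g w - h *: L) <= e / 3 / (normc (phi w) + 1) * normc h.
  by apply: HL; rewrite !divr_gt0.
(* [C^-1] keeps [phi (w + h)] within 1 of [phi w]. The other radii give a third of [e] to each term:
   the error of [phi], the error of [g], and the increment of [phi] times the linear part of [g],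
   which is of second order. *)
exists (Num.min (Num.min d1 C^-1) (Num.min (Num.min d2 d3) (e / 3 / C / (rnorm L + 1)))).
  by rewrite !lt_min d10 d20 d30 invr_gt0 C0 !divr_gt0.
move=> h; rewrite !lt_min => /andP[/andP[hd1 hd4] /andP[/andP[hd2 hd3] hd5]].
set h' := phi (w + h); set g' := g (w + h).
have hC : normc (h' - phi w) <= C * normc h by exact: H1.
have -> : h' *: g' - phi w *: g w - h *: (c *: g w + phi w *: L) =
   (h' - phi w - h * c) *: g w + h' *: (g' - g w - h *: L) + (h' - phi w) *: (h *: L).
  rewrite !scalerBl !scalerBr scalerDr !scalerA (mulrC h (phi w)) opprD.
  set a := h' *: g'; set b := h' *: g w; set p := phi w *: g w.
  set q := (h * c) *: g w; set r := (h' * h) *: L; set s := (phi w * h) *: L.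
  rewrite !addrA [RHS](ACl (4*2*3*8*(1*5)*(6*7)))/=.
  by rewrite subrr addr0 addNr addr0.
rewrite (le_trans (rnormD _ _))// (le_trans (lerD (rnormD _ _) (lexx _)))//.
have -> : e * normc h = e / 3 * normc h + e / 3 * normc h + e / 3 * normc h by lra.
have small (x b a : R) : 0 <= b -> x <= a / (b + 1) * normc h -> 0 <= a -> x * b <= a * normc h.
  move=> b0 xa a0; rewrite (le_trans (ler_wpM2r b0 xa))// mulrAC ler_wpM2r ?normc_ge0//.
  by rewrite mulrAC ler_pdivrMr ?ltr_wpDl// ler_wpM2l// lerDl.
have e3 : 0 <= e / 3 by rewrite divr_ge0// ltW.
apply: lerD; first apply: lerD.
- by rewrite rnormZ small ?rnorm_ge0// H2.
- rewrite rnormZ mulrC (le_trans (ler_wpM2l (rnorm_ge0 _) (_ : _ <= normc (phi w) + 1)))//.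
    rewrite -(subrK (phi w) h') addrC (le_trans (le_normcD _ _))// lerD2l.
    rewrite (le_trans hC)// mulrC -ler_pdivlMr// mul1r ltW//.
  rewrite (le_trans (ler_wpM2r (ltW P0) (H3 _ hd3)))// mulrAC ler_wpM2r ?normc_ge0//.
  by rewrite divfK// gt_eqF.
- rewrite !rnormZ mulrA mulrAC ler_wpM2r ?normc_ge0//.
  apply: (@le_trans _ _ (C * (e / 3 / C / (rnorm L + 1)) * (rnorm L + 1))).
    apply: ler_pM; rewrite ?normc_ge0 ?rnorm_ge0 ?lerDl//.
    by rewrite (le_trans hC)// ler_wpM2l// ltW.
  by rewrite -mulrA divfK ?gt_eqF// mulrC divfK// gt_eqF.
Qed.

Lemma scdiff_expcM (a : R[i]) : scdiff (fun w => expc (a * w)).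
Proof.
move=> w; exists (a * expc (a * w)) => e e0.
have A0 : 0 < normc a + 1 by rewrite ltr_wpDl// normc_ge0.
have E0 : 0 < normc (expc (a * w)) by rewrite normc_expc expR_gt0.
have [d d0 H] := expc_derive0 (divr_gt0 (divr_gt0 e0 E0) A0).
exists (d / (normc a + 1)) => [|h]; first by rewrite divr_gt0.
rewrite ltr_pdivlMr// => hd.
have ah : normc (a * h) <= normc h * (normc a + 1).
  by rewrite normcM mulrC ler_wpM2l ?normc_ge0// lerDl.
have -> : expc (a * (w + h)) - expc (a * w) - h * (a * expc (a * w)) =
  expc (a * w) * (expc (a * h) - 1 - a * h) by rewrite mulrDr expcD; ring.
rewrite normcM (le_trans (ler_wpM2l (normc_ge0 _) (H _ (le_lt_trans ah hd))))//.
rewrite (le_trans (ler_wpM2l (normc_ge0 _) (ler_wpM2l _ ah))) ?divr_ge0 ?normc_ge0 ?(ltW e0) ?(ltW A0)//.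
rewrite le_eqVlt; apply/orP; left; apply/eqP; field.
by rewrite !gt_eqF.
Qed.

Lemma cdiff_scaleX g n : cdiff g -> cdiff (fun w => w ^+ n *: g w).
Proof.
move=> dg; elim: n => [|n ih].
  by have -> : (fun w => w ^+ 0 *: g w) = g by apply/funext => w; rewrite scale1r.
have -> : (fun w => w ^+ n.+1 *: g w) = (fun w => w *: (w ^+ n *: g w)).
  by apply/funext => w; rewrite scalerA exprS.
apply: cdiff_scale => // w; exists 1 => e e0; exists 1 => // h _.
rewrite [w + h]addrC addrK mulr1 subrr normc0 mulr_ge0 ?normc_ge0 ?ltW//.
Qed.

(* Averages over the [2 ^ N]-th roots of unity replace integrals over the circle. *)
Definition cmean N (F : R[i] -> Y) : Y :=
  (2 ^- N) *: \sum_(0 <= k < 2 ^ N) F (unity (2 ^ N) ^+ k).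

Lemma cmeanZ N (a : R[i]) F : cmean N (fun x => a *: F x) = a *: cmean N F.
Proof. by rewrite /cmean -scaler_sumr scalerA mulrC -scalerA. Qed.

Lemma cmeanB N F F' : cmean N (fun x => F x - F' x) = cmean N F - cmean N F'.
Proof. by rewrite /cmean sumrB scalerBr. Qed.

Lemma cmean_sum N (I : Type) (s : seq I) (F : I -> R[i] -> Y) :
  cmean N (fun x => \sum_(i <- s) F i x) = \sum_(i <- s) cmean N (F i).
Proof. by rewrite /cmean exchange_big/= scaler_sumr. Qed.

Lemma eq_cmean N F F' : (forall x, normc x = 1 -> F x = F' x) ->
  cmean N F = cmean N F'.
Proof.
by move=> FF; rewrite /cmean; congr (_ *: _); apply: eq_bigr => k _; rewrite FF// normc_unityX.
Qed.

Lemma normc_2Vn N : normc (2 ^- N : R[i]) = 2 ^- N.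
Proof. by rewrite normcV normcX -[2]/(2%:R) -(rmorph_nat (real_complex R)) normcR ger0_norm. Qed.

Lemma cmean_le N F (b : R) : (forall x, normc x = 1 -> rnorm (F x) <= b) ->
  rnorm (cmean N F) <= b.
Proof.
move=> Fb; rewrite /cmean rnormZ normc_2Vn ler_pdivrMl ?exprn_gt0//.
rewrite (le_trans (rnorm_sum _ _))//.
rewrite (_ : _ * b = \sum_(0 <= k < 2 ^ N) b); last first.
  by rewrite sumr_const_nat subn0 -[RHS]mulr_natl natrX.
by apply: ler_sum => k _; rewrite Fb// normc_unityX.
Qed.

Lemma cmean_cst N (y : Y) : cmean N (fun=> y) = y.
Proof.
rewrite /cmean sumr_const_nat subn0 -[y *+ _]scaler_nat scalerA natrX mulVf ?scale1r//.
Qed.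

Lemma cmeanX0 N l (y : Y) : (0 < l < 2 ^ N)%N ->
  cmean N (fun x => x ^+ l *: y) = 0.
Proof. by move=> lN; rewrite /cmean -scaler_suml unity_sumX// scale0r scaler0. Qed.

Lemma cmeanV0 N l (y : Y) : (0 < l < 2 ^ N)%N ->
  cmean N (fun x => x ^- l *: y) = 0.
Proof. by move=> lN; rewrite /cmean -scaler_suml unity_sumV// scale0r scaler0. Qed.

(** The left endpoints of the dyadic partition of a period are sent by the exponential exactly to
    the rotated roots of unity, so no approximation is involved. *)
Lemma seg_mean_circle n g w :
  seg_mean n (g \o expc) w (0 +i* (pi *+ 2)) = cmean n (fun x => g (expc w * x)).
Proof.
rewrite /seg_mean /cmean; congr (_ *: _); apply: eq_bigr => k _ /=; congr g.
rewrite expcD -cisMn; congr (_ * _); rewrite /cis; congr expc.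
have -> : k%:R / 2 ^+ n = (k%:R / 2 ^+ n : R)%:C :> R[i].
  by rewrite rmorphM/= fmorphV rmorphXn/= !rmorph_nat.
rewrite -[LHS]/((k%:R / 2 ^+ n * 0 - 0 * (pi *+ 2)) +i*
                (k%:R / 2 ^+ n * (pi *+ 2) + 0 * 0)).
rewrite mulr0 !mul0r subr0 addr0 -(mulr_natr (_ / _)) natrX.
by congr (0 +i* _); ring.
Qed.

(** The function exp(- l w) g(exp w) has period 2 i pi, so in its circulation the two sides that
    join the logarithms of [mu] and [lam] cancel. Goursat's theorem then compares the two sides
    parallel to the period, which are the two circle means. *)
Lemma cmean_circle_indep g l (lam mu : R[i]) : cdiff g -> lam != 0 -> mu != 0 ->
  tends (fun N => lam ^- l *: cmean N (fun x => x ^- l *: g (lam * x)) -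
                  mu ^- l *: cmean N (fun x => x ^- l *: g (mu * x))) 0.
Proof.
move=> dg lam0 mu0.
have [w wE] := expc_surj lam0; have [w' wE'] := expc_surj mu0.
pose G w := expc (- l%:R * w) *: g (expc w).
have dexp : scdiff (@expc R).
  move=> z; have [c Hc] := scdiff_expcM 1 z; exists c => e e0.
  have [d d0 H] := Hc e e0; exists d => // h hd; have := H h hd.
  by rewrite !mul1r.
have dG : cdiff G.
  by apply: cdiff_scale; [exact: (cdiff_comp dg dexp)|exact: scdiff_expcM].
have expcV (z : R[i]) : expc (- l%:R * z) = expc z ^- l.
  apply: (@mulIf _ (expc z ^+ l)); first by rewrite expf_neq0// expc_neq0.
  rewrite mulVf ?expf_neq0 ?expc_neq0// -expcMn -expcD mulNr mulr_natl addNr.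
  exact: expc0.
have GE : G = (fun y => y ^- l *: g y) \o @expc R.
  by apply/funext => z; rewrite /G expcV.
pose v : R[i] := 0 +i* (pi *+ 2).
have v0 : v != 0.
  by rewrite -normc_eq0 /= expr0n/= add0r sqrtr_sqr normr_eq0 gt_eqF// mulrn_wgt0// pi_gt0.
have ev : expc v = 1 by rewrite -[expc _]/(cis _) cisE cos2pi sin2pi.
have nv : 0 < normc v by rewrite lt_neqAle normc_ge0 eq_sym normc_eq0 v0.
have M z n : seg_mean n G z v =
    expc z ^- l *: cmean n (fun x => x ^- l *: g (expc z * x)).
  rewrite GE seg_mean_circle -cmeanZ; congr cmean.
  by apply/funext => x; rewrite exprMn invfM scalerA.
move=> e e0; have [N HN] := @goursat _ _ G w' (w - w') v (e * normc v) dG (mulr_gt0 e0 nv).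
exists N => // n /= Nn; rewrite subr0 -wE -wE'.
rewrite -!M.
have := HN n Nn; rewrite /circulation.
have -> : seg_mean n G (w' + v) (w - w') = seg_mean n G w' (w - w').
  rewrite /seg_mean; congr (_ *: _); apply: eq_bigr => k _; rewrite GE/=.
  by rewrite (addrAC w' v) (expcD _ v) ev mulr1.
rewrite subrr scaler0 add0r [w' + _]addrC subrK rnormZ mulrC.
by rewrite ltr_pM2r.
Qed.

(** The circle is shrunk to the radius [m], where the Lipschitz estimate at 0 keeps [g] within e / 4
    of its value at 0. *)
Lemma cmean_value g (lam : R[i]) : cdiff g ->
  tends (fun N => cmean N (fun x => g (lam * x))) (g 0).
Proof.
move=> dg; have [->|lam0] := eqVneq lam 0.
  move=> e e0; near=> N.
  under eq_cmean do rewrite mul0r.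
  by rewrite cmean_cst subrr rnorm0.
have [C C0 [d d0 H]] := cdiff_lip 0 dg => e e0.
pose m : R := Num.min (d / 2) (e / 4 / C).
have m0 : 0 < m by rewrite lt_min !divr_gt0.
have md : m < d by rewrite gt_min ltr_pdivrMr// ltr_pMr// ltr1n.
have mC : C * m <= e / 4.
  by rewrite mulrC -ler_pdivlMr// ge_min lexx orbT.
have mu0 : m%:C != 0 by rewrite -normc_eq0 normcR normr_eq0 gt_eqF.
have e2 : 0 < e / 2 by rewrite divr_gt0.
have := cmean_circle_indep 0 dg lam0 mu0 e2; apply: filterS => N.
have E0 (a : R[i]) : cmean N (fun x => x ^- 0 *: g (a * x)) = cmean N (fun x => g (a * x)).
  by apply: eq_cmean => x _; rewrite expr0 invr1 scale1r.
rewrite !E0 !expr0 !invr1 !scale1r subr0.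
move=> LN; rewrite (le_lt_trans (rnorm_distD (cmean N (fun x => g (m%:C * x))) _ _))//.
have : rnorm (cmean N (fun x => g (m%:C * x)) - g 0) <= e / 4.
  rewrite -{1}(cmean_cst N (g 0)) -cmeanB; apply: cmean_le => x x1.
  have := H (m%:C * x); rewrite add0r normcM normcR x1 mulr1 gtr0_norm// => /(_ md).
  by move=> /le_trans; apply.
by move: LN; lra.
Unshelve. all: by end_near. Qed.

(** The mean value property of w^r g(w), which vanishes at 0, divided by lam^r: there are no Laurent
    coefficients of negative degree. *)
Lemma cmean_positive_coef g (lam : R[i]) r : cdiff g -> (0 < r)%N ->
  tends (fun N => cmean N (fun x => x ^+ r *: g (lam * x))) 0.
Proof.
move=> dg r0; have [->|lam0] := eqVneq lam 0.
  move=> e e0; exists r => // N /= rN; rewrite subr0.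
  under eq_cmean do rewrite mul0r.
  by rewrite cmeanX0 ?rnorm0// r0 (leq_ltn_trans rN)// ltn_expl.
have := tendsZ (lam ^- r) (cmean_value lam (cdiff_scaleX r dg)).
rewrite expr0n (gtn_eqF r0) scale0r scaler0; apply: tends_eq; near=> N.
rewrite -cmeanZ; apply: eq_cmean => x _; rewrite scalerA; congr (_ *: _).
by rewrite exprMn mulrA mulVf ?mul1r// expf_neq0.
Unshelve. all: by end_near. Qed.

(** The circle through [lam] is compared with the unit circle. For [lam = 0] the mean is exactly
    zero once 0 < l < 2^N, and [l = 0] is the mean value property. *)
Lemma cmean_negative_coef g (lam : R[i]) l : cdiff g ->
  tends (fun N => cmean N (fun x => x ^- l *: g (lam * x)) -
                  lam ^+ l *: cmean N (fun x => x ^- l *: g x)) 0.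
Proof.
move=> dg; have [->|lam0] := eqVneq lam 0; last first.
  have := tendsZ (lam ^+ l) (cmean_circle_indep l dg lam0 (oner_neq0 _)).
  rewrite scaler0; apply: tends_eq; near=> N.
  rewrite expr1n invr1 scale1r scalerBr scalerA mulfV ?expf_neq0// scale1r.
  by congr (_ - _ *: _); apply: eq_cmean => x _; rewrite mul1r.
have [->|l0] := posnP l.
  have := tendsB (cmean_value 0 dg) (cmean_value 1 dg); rewrite subrr.
  apply: tends_eq; near=> N; rewrite expr0 scale1r.
  by congr (_ - _); apply: eq_cmean => x _; rewrite expr0 invr1 scale1r ?mul1r.
move=> e e0; exists l => // N /= lN.
rewrite expr0n (gtn_eqF l0) scale0r !subr0.
under eq_cmean do rewrite mul0r.
by rewrite cmeanV0 ?rnorm0// l0 (leq_ltn_trans lN)// ltn_expl.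
Unshelve. all: by end_near. Qed.

End circle_means.

(** * The Fejer kernel on roots of unity *)

Section fejer_kernel.
Context {R : realType}.
Implicit Types (x y : R[i]).

Definition rmean N (F : R[i] -> R) : R :=
  2 ^- N * \sum_(0 <= k < 2 ^ N) F (unity (2 ^ N) ^+ k).

Lemma ler_rmean N F F' : (forall x, normc x = 1 -> F x <= F' x) ->
  rmean N F <= rmean N F'.
Proof.
move=> FF; rewrite /rmean ler_wpM2l ?invr_ge0 ?exprn_ge0//.
by apply: ler_sum => k _; rewrite FF// normc_unityX.
Qed.

Lemma rmeanMr N F (b : R) : rmean N (fun x => F x * b) = rmean N F * b.
Proof. by rewrite /rmean -mulr_suml mulrA. Qed.

Lemma rmeanD N F F' : rmean N (fun x => F x + F' x) = rmean N F + rmean N F'.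
Proof. by rewrite /rmean big_split/= mulrDr. Qed.

Lemma rmean_cst N (b : R) : rmean N (fun=> b) = b.
Proof.
rewrite /rmean sumr_const_nat subn0 -[b *+ _]mulr_natl natrX mulrA mulVf ?mul1r//.
Qed.

Lemma rnorm_cmean {Y : completeNormedModType R[i]} N (F : R[i] -> Y) :
  rnorm (cmean N F) <= rmean N (fun x => rnorm (F x)).
Proof.
rewrite /cmean rnormZ normc_2Vn /rmean ler_wpM2l ?invr_ge0 ?exprn_ge0//.
exact: rnorm_sum.
Qed.

(** As a squared modulus the kernel is visibly nonnegative; [fejerE] gives its expansion in powers
    of [x] of degree between - (n - 1) and n - 1. *)
Definition fejer n x : R := n%:R^-1 * normc (\sum_(0 <= a < n) x ^+ a) ^+ 2.

Lemma fejer_ge0 n x : 0 <= fejer n x.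
Proof. by rewrite mulr_ge0 ?invr_ge0 ?ler0n// sqr_ge0. Qed.

Lemma unit_conj x : normc x = 1 -> x^*%C = x^-1.
Proof.
move=> x1; have x0 : x != 0 by rewrite -normc_eq0 x1 oner_neq0.
apply: (mulfI x0); rewrite mulfV// -sqr_normc normcE x1.
by rewrite expr1n.
Qed.

Lemma normc_sqr x : (normc x ^+ 2)%:C = x * x^*%C.
Proof. by rewrite -sqr_normc normcE rmorphXn. Qed.

Lemma fejerE n x : normc x = 1 -> (fejer n x)%:C =
  n%:R^-1 * \sum_(0 <= a < n) \sum_(0 <= b < n) x ^+ a * x ^- b.
Proof.
move=> x1; rewrite /fejer rmorphM/= fmorphV rmorph_nat normc_sqr; congr (_ * _).
rewrite rmorph_sum mulr_suml; apply: eq_bigr => a _.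
rewrite mulr_sumr; apply: eq_bigr => b _.
by rewrite rmorphXn/= unit_conj// exprVn.
Qed.

Lemma unit_mulXV x a b : normc x = 1 -> x ^+ a * x ^- b =
  if (b <= a)%N then x ^+ (a - b) else x ^- (b - a).
Proof.
move=> x1; have x0 : x != 0 by rewrite -normc_eq0 x1 oner_neq0.
case: leqP => [ba|/ltnW ab].
  by rewrite -{1}(subnK ba) exprD mulfK// expf_neq0.
rewrite -{1}(subnK ab) exprD invfM mulrCA mulfV ?mulr1// expf_neq0//.
Qed.

(** Of the products x^a x^-b only the diagonal ones have nonzero mean: n <= 2^N ensures that |a - b|
    < 2^N, so that orthogonality applies to the others. *)
Lemma rmean_fejer N n : (0 < n <= 2 ^ N)%N -> rmean N (fejer n) = 1.
Proof.
move=> /andP[n0 nN]; apply: complexI; rewrite /rmean rmorphM/= rmorph_sum/=.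
rewrite (eq_bigr (fun k => n%:R^-1 * \sum_(0 <= a < n) \sum_(0 <= b < n)
   (unity (2 ^ N) ^+ k : R[i]) ^+ a * (unity (2 ^ N) ^+ k) ^- b)) => [|k _]; last first.
  by rewrite fejerE// normc_unityX.
rewrite -mulr_sumr exchange_big/= mulrCA mulr_sumr.
rewrite big_nat (eq_bigr (fun=> 1)); last first.
  move=> a /andP[_ an]; rewrite exchange_big/=.
  rewrite (bigD1_seq a) ?iota_uniq ?mem_index_iota//= [X in _ + X]big1_seq ?addr0.
    rewrite (eq_bigr (fun=> 1)) => [|k _]; last first.
      by rewrite mulfV// expf_neq0// unityX_neq0.
    rewrite sumr_const_nat subn0 fmorphV natrX rmorphXn/= rmorph_nat mulVf//.
  move=> b /andP[ba]; rewrite mem_index_iota => /andP[_ bn].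
  have [ab|ab|ab] := ltngtP b a; last by rewrite ab eqxx in ba.
    rewrite (eq_bigr (fun k => (unity (2 ^ N) ^+ k) ^+ (a - b))) => [|k _].
      by rewrite unity_sumX//; lia.
    by rewrite unit_mulXV ?normc_unityX// ltnW.
  rewrite (eq_bigr (fun k => (unity (2 ^ N) ^+ k) ^- (b - a))) => [|k _].
    by rewrite unity_sumV//; lia.
  by rewrite unit_mulXV ?normc_unityX// leqNgt ab.
rewrite -big_nat sumr_const_nat subn0 mulVf//.
by rewrite pnatr_eq0 -lt0n.
Qed.

Lemma unit_sum_le n x : normc x = 1 -> normc (\sum_(0 <= a < n) x ^+ a) <= n%:R.
Proof.
move=> x1; rewrite (le_trans (normc_sum _ _))//.
under eq_bigr do rewrite normcX x1 expr1n.
by rewrite sumr_const_nat subn0.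
Qed.

Lemma fejer_le n x : normc x = 1 -> fejer n x <= n%:R.
Proof.
move=> x1; have [->|n0] := posnP n; first by rewrite /fejer invr0 mul0r.
rewrite /fejer ler_pdivrMl ?ltr0n// -expr2 lerXn2r ?nnegrE ?normc_ge0 ?ler0n//.
exact: unit_sum_le.
Qed.

(** The factor x - 1 telescopes the geometric sum into x^n - 1, of modulus at most 2. *)
Lemma fejer_concentration n x : (0 < n)%N -> normc x = 1 ->
  fejer n x * normc (x - 1) ^+ 2 <= 4 / n%:R.
Proof.
move=> n0 x1; rewrite /fejer -mulrA -exprMn -normcM mulrC ler_pM2r ?invr_gt0 ?ltr0n//.
rewrite big_mkord mulrC -subrX1.
have : normc (x ^+ n - 1) <= 2.
  by rewrite (le_trans (normcB _ _))// normcX x1 expr1n normc1; lra.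
have := normc_ge0 (x ^+ n - 1); nra.
Qed.

Lemma unitX_lip a y : normc y = 1 -> normc (y ^+ a - 1) <= a%:R * normc (y - 1).
Proof.
move=> y1; rewrite subrX1 normcM mulrC ler_wpM2r ?normc_ge0//.
by rewrite -(big_mkord xpredT (fun i => y ^+ i)) unit_sum_le.
Qed.

(** The difference of squares factors: the sums differ by at most n^2 |y - 1|, their moduli add up
    to at most 2 n, and one [n] is divided out. *)
Lemma fejer_lip n x y : normc x = 1 -> normc y = 1 ->
  `|fejer n (x * y) - fejer n x| <= 2 * n%:R ^+ 2 * normc (y - 1).
Proof.
move=> x1 y1; have [->|n0] := posnP n.
  by rewrite /fejer invr0 !mul0r subrr normr0 expr0n/= mulr0 mul0r.
have xy1 : normc (x * y) = 1 by rewrite normcM x1 y1 mulr1.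
have n0' : (0 : R) < n%:R by rewrite ltr0n.
rewrite /fejer -mulrBr normrM gtr0_norm ?invr_gt0// ler_pdivrMl//.
have := unit_sum_le n x1; have := unit_sum_le n xy1.
set S := \sum_(0 <= a < n) x ^+ a; set S' := \sum_(0 <= a < n) (x * y) ^+ a => Sn' Sn.
have SS : normc (S' - S) <= n%:R ^+ 2 * normc (y - 1).
  rewrite -sumrB (le_trans (normc_sum _ _))//.
  apply: (@le_trans _ _ (\sum_(0 <= a < n) n%:R * normc (y - 1))).
    rewrite big_nat [leRHS]big_nat; apply: ler_sum => a /andP[_ an].
    rewrite exprMn -{2}[x ^+ a]mulr1 -mulrBr normcM normcX x1 expr1n mul1r.
    rewrite (le_trans (unitX_lip _ y1))// ler_wpM2r ?normc_ge0// ler_nat ltnW//.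
  by rewrite sumr_const_nat subn0 -[_ *+ n]mulr_natl mulrA -expr2.
rewrite subr_sqr normrM.
have A : `|normc S' - normc S| <= normc (S' - S).
  have := le_normcD (S' - S) S; rewrite subrK => h1.
  have := le_normcD (S - S') S'; rewrite subrK normc_distC => h2.
  by rewrite ler_norml; lra.
have B : `|normc S' + normc S| <= 2 * n%:R.
  by rewrite ger0_norm ?addr_ge0 ?normc_ge0//; lra.
apply: (@le_trans _ _ (n%:R ^+ 2 * normc (y - 1) * (2 * n%:R))).
  by apply: ler_pM => //; rewrite (le_trans A).
by rewrite le_eqVlt; apply/orP; left; apply/eqP; ring.
Qed.

End fejer_kernel.

(** * Fejer means in one coordinate *)

Section fejer_means.
Context {R : realType} {d : nat} {Y : completeNormedModType R[i]}.
Local Notation X := 'rV[R[i]]_d.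
Implicit Types (f g : X -> Y) (z : X) (i j : 'I_d) (x y : R[i]).

Definition upd z j x : X := \row_i (if i == j then x else z 0 i).

Definition rot j x z : X := upd z j (z 0 j * x).

Definition polydisc (M : R) z := forall i, normc (z 0 i) <= M.

(** Entire functions have this property by compactness and Fejer means keep it; it yields the
    existence of the limits in [N], uniformly on polydiscs, and measurability. *)
Definition tame f :=
  (forall M, exists C : R, forall z, polydisc M z -> rnorm (f z) <= C) /\
  (forall M (e : R), 0 < e -> exists2 del : R, 0 < del & forall z z',
    polydisc M z -> polydisc M z' -> (forall i, normc (z 0 i - z' 0 i) < del) ->
    rnorm (f z - f z') <= e).

Lemma updE z j x i : upd z j x 0 i = if i == j then x else z 0 i.
Proof. by rewrite mxE. Qed.

Lemma upd_upd z j x y : upd (upd z j x) j y = upd z j y.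
Proof. by apply/rowP => i; rewrite !updE; case: eqP. Qed.

Lemma updC z i j x y : i != j -> upd (upd z i x) j y = upd (upd z j y) i x.
Proof.
move=> ij; apply/rowP => k; rewrite !updE; case: eqP => // ->.
by rewrite eq_sym (negbTE ij).
Qed.

Lemma rot_upd j x y z : rot j x (upd z j y) = upd z j (y * x).
Proof. by rewrite /rot updE eqxx upd_upd. Qed.

Lemma upd_rotC i j x y z : i != j -> upd (rot j x z) i y = rot j x (upd z i y).
Proof.
by move=> ij; rewrite /rot updC 1?eq_sym// updE eq_sym (negbTE ij).
Qed.

Lemma rotC i j x y z : i != j -> rot i x (rot j y z) = rot j y (rot i x z).
Proof.
move=> ij; rewrite /rot updC 1?eq_sym// !updE (negbTE ij) eq_sym (negbTE ij).
by rewrite updC// eq_sym.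
Qed.

Lemma rot_coord i j x z : i != j -> rot j x z 0 i = z 0 i.
Proof. by move=> ij; rewrite updE (negbTE ij). Qed.

Lemma normc_rot i j x z : normc x = 1 -> normc (rot j x z 0 i) = normc (z 0 i).
Proof. by move=> x1; rewrite updE; case: eqP => // ->; rewrite normcM x1 mulr1. Qed.

Lemma polydisc_rot M j x z : normc x = 1 -> polydisc M z -> polydisc M (rot j x z).
Proof. by move=> x1 Mz i; rewrite normc_rot. Qed.

Lemma polydisc_upd1 M j z : polydisc M z -> 1 <= M -> polydisc M (upd z j 1).
Proof. by move=> Mz M1 i; rewrite updE; case: eqP => // _; rewrite normc1. Qed.

Lemma polydisc_exists z : exists2 M : R, 1 <= M & polydisc M z.
Proof.
exists (1 + \sum_i normc (z 0 i)).
  by rewrite lerDl sumr_ge0// => i _; exact: normc_ge0.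
move=> i; rewrite (bigD1 i)//= addrCA lerDl addr_ge0// sumr_ge0// => k _.
exact: normc_ge0.
Qed.

Definition avg N j (phi : R[i] -> R[i]) f z : Y :=
  cmean N (fun x => phi x *: f (rot j x z)).

Definition fejer_avg N n j f z : Y := avg N j (fun x => (fejer n x)%:C) f z.

(** The limit is meaningful only where the averages converge, which [fejer_mean_tends] provides for
    [tame] functions. *)
Definition fejer_mean n j f z : Y := lim (fejer_avg N n j f z @[N --> \oo]).

Lemma sum_nat_mul (p q : nat) (F : nat -> Y) :
  \sum_(0 <= k < p * q) F k = \sum_(0 <= a < p) \sum_(0 <= b < q) F (a * q + b)%N.
Proof.
elim: p => [|p ih]; first by rewrite mul0n !big_nil.
rewrite big_nat_recr//= -ih mulSn addnC (@big_cat_nat _ _ _ (p * q)%N) ?leq_addr//=.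
congr (_ + _); rewrite -{1}[(p * q)%N]add0n big_addn addKn.
by apply: eq_bigr => b _; rewrite addnC.
Qed.

(** The 2^N nodes are grouped into 2^N0 arcs: node a 2^m + b is the a-th coarse node times a factor
    of angle less than 2 pi / 2^N0, so [F] varies by at most [e] on each arc. *)
Lemma cmean_refine N0 N (F : R[i] -> Y) (del e : R) : (N0 <= N)%N ->
  (forall x y, normc x = 1 -> normc y = 1 -> normc (y - 1) <= del ->
     rnorm (F (x * y) - F x) <= e) ->
  (forall t : R, 0 <= t <= pi *+ 2 / 2 ^+ N0 -> normc (cis t - 1) <= del) ->
  rnorm (cmean N F - cmean N0 F) <= e.
Proof.
move=> N0N FF Hdel; pose m := (N - N0)%N.
have NE : N = (N0 + m)%N by rewrite subnKC.
have um : (unity (2 ^ N) : R[i]) ^+ (2 ^ m) = unity (2 ^ N0).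
  rewrite /unity -cisMn; congr cis; rewrite -(mulr_natr (_ / _)) NE expnD !natrX natrM.
  by rewrite !natrX; field; rewrite !expf_neq0.
rewrite {1}/cmean [X in \sum_(0 <= k < X) _](_ : _ = 2 ^ N0 * 2 ^ m)%N; last first.
  by rewrite -expnD -NE.
rewrite sum_nat_mul.
have -> : cmean N0 F = 2 ^- N *: \sum_(0 <= a < 2 ^ N0) \sum_(0 <= b < 2 ^ m)
    F (unity (2 ^ N0) ^+ a).
  rewrite (eq_bigr (fun a => (2 ^ m)%:R *: F (unity (2 ^ N0) ^+ a))) => [|a _].
    rewrite -scaler_sumr scalerA NE exprD invfM natrX -mulrA mulVf ?mulr1//.
  by rewrite sumr_const_nat subn0 scaler_nat.
rewrite -scalerBr -sumrB rnormZ normc_2Vn ler_pdivrMl ?exprn_gt0//.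
rewrite (le_trans (rnorm_sum _ _))//.
rewrite (_ : _ * e = \sum_(0 <= a < 2 ^ N0) \sum_(0 <= b < 2 ^ m) e); last first.
  rewrite !sumr_const_nat !subn0 -mulrnA -expnD addnC -NE.
  by rewrite -[RHS]mulr_natl natrX.
apply: ler_sum => a _; rewrite -sumrB (le_trans (rnorm_sum _ _))//.
rewrite big_nat [leRHS]big_nat; apply: ler_sum => b /andP[_ bm].
rewrite exprD mulnC exprM um; apply: FF; rewrite ?normc_unityX//.
rewrite -cisMn; apply: Hdel; rewrite -(mulr_natr (_ / _)); apply/andP; split.
  by apply: mulr_ge0 => //; apply: divr_ge0 => //; rewrite mulrn_wge0// pi_ge0.
rewrite NE expnD natrM !natrX invfM !mulrA -mulrA ler_piMr//.
  by apply: divr_ge0; rewrite ?exprn_ge0// mulrn_wge0// pi_ge0.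
by rewrite ler_pdivrMl ?exprn_gt0// mulr1 -natrX ler_nat ltnW.
Qed.

Lemma cis_near1 (del : R) : 0 < del -> exists N0,
  forall t : R, 0 <= t <= pi *+ 2 / 2 ^+ N0 -> normc (cis t - 1) <= del.
Proof.
move=> del0; have [d' d'0 H] := @expc_derive0 R 1 ltr01.
pose m : R := Num.min (d' / 2) (del / 2).
have m0 : 0 < m by rewrite lt_min !divr_gt0.
exists (Num.bound (pi *+ 2 / m)) => t /andP[t0 tN].
have tm : t <= m.
  rewrite (le_trans tN)// ler_pdivrMr ?exprn_gt0// mulrC -ler_pdivrMr//.
  by rewrite ltW//; exact: upper_nthrootP.
have nt : normc (0 +i* t) = t by rewrite /= expr0n/= add0r sqrtr_sqr ger0_norm.
have := H (0 +i* t); rewrite nt mul1r => Ht.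
have td : t < d'.
  by rewrite (le_lt_trans tm)// gt_min ltr_pdivrMr// ltr_pMr// ltr1n.
have {}Ht := Ht td.
have := le_normcD (expc (0 +i* t) - 1 - (0 +i* t)) (0 +i* t).
rewrite subrK nt -/(cis t) => /le_trans; apply.
have : m <= del / 2 by rewrite ge_min lexx orbT.
rewrite -/(cis t) in Ht; lra.
Qed.

Lemma fejer_integrand_modulus f n j (M e : R) : tame f -> 0 < e ->
  exists2 del : R, 0 < del & forall z x y, polydisc M z -> normc x = 1 ->
    normc y = 1 -> normc (y - 1) <= del ->
    rnorm ((fejer n (x * y))%:C *: f (rot j (x * y) z) -
           (fejer n x)%:C *: f (rot j x z)) <= e.
Proof.
move=> [bf ucf] e0; have [C HC] := bf M.
have C0 : 0 < `|C| + 1 by rewrite ltr_wpDl.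
have K0 : (0 : R) < 2 * n%:R ^+ 2 + 1 by rewrite ltr_wpDl// mulr_ge0// exprn_ge0.
have N0 : (0 : R) < n%:R + 1 by rewrite ltr_wpDl.
have M0 : 0 < `|M| + 1 by rewrite ltr_wpDl.
have e2 : 0 < e / 2 / (n%:R + 1) by rewrite !divr_gt0.
have [d1 d10 H1] := ucf M _ e2.
(* The first radius brings the rotated points closer than [d1], the second controls the kernel
   through [fejer_lip]. Absolute values and added ones keep the denominators positive even if [M] or
   [C] is negative. *)
exists (Num.min (d1 / 2 / (`|M| + 1)) (e / 2 / (`|C| + 1) / (2 * n%:R ^+ 2 + 1))).
  by rewrite lt_min !divr_gt0.
move=> z x y Mz x1 y1; rewrite le_min => /andP[yd1 yd2].
have xy1 : normc (x * y) = 1 by rewrite normcM x1 y1 mulr1.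
set a := (fejer n (x * y))%:C; set b := (fejer n x)%:C.
set F := f _; set G := f _.
have -> : a *: F - b *: G = (a - b) *: F + b *: (F - G).
  by rewrite scalerBl scalerBr addrA subrK.
rewrite (le_trans (rnormD _ _))// !rnormZ.
have -> : e = e / 2 + e / 2 by lra.
apply: lerD.
  rewrite /a /b -rmorphB normcR.
  apply: (@le_trans _ _ (((2 * n%:R ^+ 2 + 1) * normc (y - 1)) * (`|C| + 1))).
    apply: ler_pM; rewrite ?rnorm_ge0//.
      rewrite (le_trans (fejer_lip n x1 y1))// ler_wpM2r ?normc_ge0//.
      by rewrite lerDl.
    rewrite (le_trans (HC _ (polydisc_rot j xy1 Mz)))//.
    by rewrite (le_trans (ler_norm _))// lerDl.
  rewrite -ler_pdivlMr// mulrC -ler_pdivlMr//.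
rewrite /b normcR ger0_norm ?fejer_ge0//.
apply: (@le_trans _ _ ((n%:R + 1) * (e / 2 / (n%:R + 1)))); last first.
  by rewrite mulrC divfK// gt_eqF.
apply: ler_pM; rewrite ?fejer_ge0 ?rnorm_ge0//.
  by rewrite (le_trans (fejer_le n x1))// lerDl.
apply: H1; [exact: polydisc_rot|exact: polydisc_rot|move=> i].
rewrite !updE; case: eqP => [ij|_]; last by rewrite subrr normc0.
rewrite mulrA -{2}[z 0 j * x]mulr1 -mulrBr !normcM x1 mulr1.
apply: (@le_lt_trans _ _ ((`|M| + 1) * normc (y - 1))).
  rewrite ler_wpM2r ?normc_ge0// (le_trans (Mz j))// (le_trans (ler_norm _))//.
  by rewrite lerDl.
rewrite mulrC -ltr_pdivlMr// (le_lt_trans yd1)// ltr_pM2r ?invr_gt0//.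
by rewrite ltr_pdivrMr// ltr_pMr// ltr1n.
Qed.

(** The Cauchy estimate [cau] has one threshold for a whole polydisc. Its radius is left free, since
    the limit at [z] is first obtained in some polydisc containing [z]. *)
Lemma fejer_mean_unif f n j (M e : R) : tame f -> 0 < e ->
  exists N0, forall N z, (N0 <= N)%N -> polydisc M z ->
    rnorm (fejer_avg N n j f z - fejer_mean n j f z) <= e.
Proof.
move=> tf e0.
have cau (M' e' : R) : 0 < e' -> exists N0, forall N z, (N0 <= N)%N ->
    polydisc M' z -> rnorm (fejer_avg N n j f z - fejer_avg N0 n j f z) <= e'.
  move=> e'0; have [del del0 Hd] := fejer_integrand_modulus n j M' tf e'0.
  have [N0 HN0] := cis_near1 del0; exists N0 => N z NN Mz.
  by apply: (cmean_refine NN _ HN0) => x y x1 y1 yd; exact: Hd.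
have cv z : tends (fun N => fejer_avg N n j f z) (fejer_mean n j f z).
  apply: tends_cauchy => e' e'0; have [M' _ Mz] := polydisc_exists z.
  have e3 : 0 < e' / 3 by rewrite divr_gt0.
  have [N0 H] := cau M' _ e3; exists N0 => p q /H/(_ Mz) pN /H/(_ Mz) qN.
  rewrite (le_lt_trans (rnorm_distD (fejer_avg N0 n j f z) _ _))//.
  rewrite rnorm_distC in qN; rewrite (le_lt_trans (lerD pN qN))//.
  by clear -e'0; lra.
have e2 : 0 < e / 2 by rewrite divr_gt0.
have [N0 H] := cau M _ e2; exists N0 => N z NN Mz.
rewrite (le_trans (rnorm_distD (fejer_avg N0 n j f z) _ _))//.
have -> : e = e / 2 + e / 2 by lra.
apply: lerD; first exact: H.
apply: (@tends_le _ _ (fun N => fejer_avg N0 n j f z - fejer_avg N n j f z)).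
  by apply: tendsB (cv z) => e' e'0; near=> k; rewrite subrr rnorm0.
by exists N0 => // k /= kN; rewrite rnorm_distC; exact: H.
Unshelve. all: by end_near. Qed.

Lemma fejer_mean_tends f n j z : tame f ->
  tends (fun N => fejer_avg N n j f z) (fejer_mean n j f z).
Proof.
move=> tf e e0; have [M _ Mz] := polydisc_exists z.
have e2 : 0 < e / 2 by rewrite divr_gt0.
have [N0 H] := fejer_mean_unif n j M tf e2; exists N0 => // N /= NN.
by rewrite (le_lt_trans (H _ _ NN Mz))// ltr_pdivrMr// ltr_pMr// ltr1n.
Qed.

(** The weights are nonnegative and have mean one as soon as n <= 2^N, so the average is a convex
    combination. *)
Lemma fejer_avg_dist N n j f f' z z' (b : R) : (0 < n <= 2 ^ N)%N ->
  (forall x, normc x = 1 -> rnorm (f (rot j x z) - f' (rot j x z')) <= b) ->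
  rnorm (fejer_avg N n j f z - fejer_avg N n j f' z') <= b.
Proof.
move=> nN H; rewrite /fejer_avg /avg -cmeanB (le_trans (rnorm_cmean _ _))//.
apply: (@le_trans _ _ (rmean N (fun x => fejer n x * b))).
  apply: ler_rmean => x x1; rewrite -scalerBr rnormZ normcR ger0_norm ?fejer_ge0//.
  by rewrite ler_wpM2l ?fejer_ge0// H.
by rewrite rmeanMr rmean_fejer// mul1r.
Qed.

Lemma near_fejer_size n : (0 < n)%N -> \forall N \near \oo, (0 < n <= 2 ^ N)%N.
Proof.
move=> n0; exists n => // N /= nN; rewrite n0/=.
by rewrite (leq_trans nN)// ltnW// ltn_expl.
Qed.

Lemma fejer_mean_dist n j f f' z z' (b : R) : (0 < n)%N -> tame f -> tame f' ->
  (forall x, normc x = 1 -> rnorm (f (rot j x z) - f' (rot j x z')) <= b) ->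
  rnorm (fejer_mean n j f z - fejer_mean n j f' z') <= b.
Proof.
move=> n0 tf tf' H.
apply: tends_le (tendsB (fejer_mean_tends n j z tf) (fejer_mean_tends n j z' tf')) _.
by apply: filterS (near_fejer_size n0) => N nN; exact: fejer_avg_dist.
Qed.

Lemma fejer_mean_le n j f z (b : R) : (0 < n)%N -> tame f ->
  (forall x, normc x = 1 -> rnorm (f (rot j x z)) <= b) ->
  rnorm (fejer_mean n j f z) <= b.
Proof.
move=> n0 tf H; apply: tends_le (fejer_mean_tends n j z tf) _.
apply: filterS (near_fejer_size n0) => N nN.
have := @fejer_avg_dist N n j f (fun=> 0) z z b nN.
have -> : fejer_avg N n j (fun=> 0) z = 0.
  by rewrite /fejer_avg /avg; under eq_cmean do rewrite scaler0; exact: cmean_cst.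
rewrite subr0; apply => x x1; rewrite subr0; exact: H.
Qed.

Lemma tame_fejer_mean n j f : (0 < n)%N -> tame f -> tame (fejer_mean n j f).
Proof.
move=> n0 tf; have [bf ucf] := tf; split.
  move=> M; have [C HC] := bf M; exists C => z Mz.
  by apply: fejer_mean_le => // x x1; apply: HC; exact: polydisc_rot.
move=> M e e0; have [del del0 H] := ucf M e e0; exists del => // z z' Mz Mz' zz'.
apply: fejer_mean_dist => // x x1; apply: H; [exact: polydisc_rot..|move=> i].
rewrite !updE; case: eqP => // _.
by rewrite -mulrBl normcM x1 mulr1.
Qed.

Lemma fejer_mean_approx f j (M e : R) : tame f -> 0 < e ->
  exists n0, forall n z, (n0 < n)%N -> polydisc M z ->
    rnorm (fejer_mean n j f z - f z) <= e.
Proof.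
move=> tf e0; have [bf ucf] := tf; have [C HC] := bf M.
have e2 : 0 < e / 2 by rewrite divr_gt0.
have [d1 d10 H1] := ucf M _ e2.
have M0 : 0 < `|M| + 1 by rewrite ltr_wpDl.
pose del := d1 / (`|M| + 1); have del0 : 0 < del by rewrite divr_gt0.
pose B := 2 * `|C|; have B0 : 0 <= B by rewrite mulr_ge0.
(* Chosen so that the contribution away from 1, which is B * 4 / (n del^2), is at most e / 2 when n
   > K. *)
pose K := B * 4 / del ^+ 2 / (e / 2).
exists (Num.bound K) => n z nK Mz.
have n0 : (0 < n)%N by exact: leq_ltn_trans nK.
have n0' : (0 : R) < n%:R by rewrite ltr0n.
have K0 : 0 <= K by rewrite !divr_ge0 ?mulr_ge0 ?exprn_ge0// ltW.
have Kn : K < n%:R.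
  by rewrite (lt_trans (archi_boundP K0))// ltr_nat.
(* The first term comes from uniform continuity for [x] near 1, the second from
   [fejer_concentration] elsewhere; their sum covers both cases. *)
have H x : normc x = 1 -> rnorm ((fejer n x)%:C *: (f (rot j x z) - f z)) <=
    fejer n x * (e / 2) + B * (4 / n%:R / del ^+ 2).
  move=> x1; rewrite rnormZ normcR ger0_norm ?fejer_ge0//.
  have [xd|xd] := ltP (normc (x - 1)) del.
    rewrite -[leLHS]addr0 lerD//.
      rewrite ler_wpM2l ?fejer_ge0// H1//; first exact: polydisc_rot.
      move=> i; rewrite updE; case: eqP => [->|_]; last by rewrite subrr normc0.
      rewrite -{2}[z 0 j]mulr1 -mulrBr normcM.
      apply: (@le_lt_trans _ _ ((`|M| + 1) * normc (x - 1))).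
        rewrite ler_wpM2r ?normc_ge0// (le_trans (Mz j))// (le_trans (ler_norm _))//.
        by rewrite lerDl.
      by rewrite mulrC -ltr_pdivlMr.
    by rewrite mulr_ge0// !divr_ge0 ?exprn_ge0// ltW.
  rewrite -[leLHS]add0r lerD//; first by rewrite mulr_ge0 ?fejer_ge0// ltW.
  rewrite mulrC; apply: ler_pM; rewrite ?rnorm_ge0 ?fejer_ge0//.
    rewrite (le_trans (rnormB _ _))// /B mulr_natl mulr2n.
    by apply: lerD; rewrite (le_trans (HC _ _)) ?ler_norm//; exact: polydisc_rot.
  rewrite ler_pdivlMr ?exprn_gt0// (le_trans _ (fejer_concentration n0 x1))//.
  rewrite ler_wpM2l ?fejer_ge0// lerXn2r ?nnegrE ?normc_ge0// ltW//.
apply: (@tends_le _ _ (fun N => fejer_avg N n j f z - f z)).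
  apply: tendsB (fejer_mean_tends n j z tf) _ => e' e'0; near=> N.
  by rewrite subrr rnorm0.
apply: filterS (near_fejer_size n0) => N nN.
(* Since the kernel has mean one, [f z] is itself an average and can be subtracted under the
   mean. *)
have -> : f z = cmean N (fun x => (fejer n x)%:C *: f z).
  rewrite /cmean -scaler_suml scalerA -[LHS]scale1r; congr (_ *: _).
  transitivity ((rmean N (fejer n) : R)%:C); first by rewrite rmean_fejer.
  by rewrite /rmean rmorphM/= rmorph_sum/= fmorphV rmorphXn/= rmorph_nat.
rewrite /fejer_avg /avg -cmeanB.
under eq_cmean do rewrite -scalerBr.
rewrite (le_trans (rnorm_cmean _ _))// (le_trans (ler_rmean _ H))//.
rewrite rmeanD rmeanMr rmean_fejer// rmean_cst mul1r.
rewrite [leRHS](_ : e = e / 2 + e / 2) ?lerD2l; last by lra.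
have -> : B * (4 / n%:R / del ^+ 2) = K * (e / 2) / n%:R.
  by rewrite /K; field; rewrite !gt_eqF.
by rewrite ler_pdivrMr// mulrC ler_pM2l// ltW.
Unshelve. all: by end_near. Qed.

End fejer_means.

(** * Fejer means are polynomials in the averaged coordinate *)

Section coordinatewise_polynomials.
Context {R : realType} {d : nat} {Y : completeNormedModType R[i]}.
Local Notation X := 'rV[R[i]]_d.
Implicit Types (f g : X -> Y) (z : X) (i j : 'I_d) (x y : R[i]).

(* [avg N j (fun x => x ^- l) f z] tends to the part of [f] homogeneous of
   degree [l] in the variable [j]: this part is [z_j ^ l] times a function of the
   other variables, and it vanishes for negative [l]. *)
Definition holo j f := forall z,
  (forall l, tends (fun N => avg N j (fun x => x ^- l) f z -
     z 0 j ^+ l *: avg N j (fun x => x ^- l) f (upd z j 1)) 0) /\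
  (forall l, (0 < l)%N -> tends (fun N => avg N j (fun x => x ^+ l) f z) 0).

Lemma holo_cdiff j f : (forall z, cdiff (fun x => f (upd z j x))) -> holo j f.
Proof.
move=> df z; split=> l.
  have := cmean_negative_coef (z 0 j) l (df z); apply: tends_eq; near=> N.
  rewrite /avg; congr (_ - _ *: _); apply: eq_cmean => x _ //.
  by rewrite rot_upd mul1r.
by move=> l0; exact: (cmean_positive_coef (z 0 j) (df z) l0).
Unshelve. all: by end_near. Qed.

Lemma tends_cmean q (F : nat -> R[i] -> Y) (G : R[i] -> Y) :
  (forall x, tends (F ^~ x) (G x)) -> tends (fun N => cmean q (F N)) (cmean q G).
Proof. by move=> FG; apply: tendsZ; apply: tends_sum => k; exact: FG. Qed.

Lemma cmean_exchange N N' (F : R[i] -> R[i] -> Y) :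
  cmean N (fun x => cmean N' (F x)) = cmean N' (fun y => cmean N (F ^~ y)).
Proof.
by rewrite /cmean -!scaler_sumr exchange_big/= !scalerA mulrC.
Qed.

Lemma avg_avgC N N' i j phi psi f z : i != j ->
  avg N i psi (avg N' j phi f) z = avg N' j phi (avg N i psi f) z.
Proof.
move=> ij; rewrite /avg; under eq_cmean do rewrite -cmeanZ.
rewrite cmean_exchange; apply: eq_cmean => y _; rewrite -cmeanZ.
by apply: eq_cmean => x _; rewrite !scalerA mulrC [in LHS]rotC// eq_sym.
Qed.

(** Averages in different coordinates are finite sums that commute, so the limits asserted by [holo]
    can be taken term by term. *)
Lemma holo_avg N i j phi f : i != j -> holo i f -> holo i (avg N j phi f).
Proof.
move=> ij hf z; split=> l.
  have := @tends_cmean N (fun N' x => phi x *: (avg N' i (fun x => x ^- l) f (rot j x z)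
     - rot j x z 0 i ^+ l *: avg N' i (fun x => x ^- l) f (upd (rot j x z) i 1)))
     (fun=> 0).
  rewrite cmean_cst => /(_ _) H; have {}H := H _.
  apply: tends_eq (H _); first near=> N'.
    rewrite (avg_avgC N' N phi _ f z ij) (avg_avgC N' N phi _ f (upd z i 1) ij).
    rewrite {3 4}/avg -cmeanZ -cmeanB; apply: eq_cmean => x _.
    rewrite scalerBr; congr (_ - _).
    by rewrite rot_coord// upd_rotC// scalerA mulrC -scalerA.
  move=> x; rewrite -[X in tends _ X](scaler0 _ (phi x)); apply: tendsZ.
  exact: (hf _).1.
move=> l0; have := @tends_cmean N (fun N' x => phi x *:
   avg N' i (fun x => x ^+ l) f (rot j x z)) (fun=> 0).
rewrite cmean_cst => H; apply: tends_eq (H _); first near=> N'.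
  by rewrite avg_avgC.
move=> x; rewrite -[X in tends _ X](scaler0 _ (phi x)); apply: tendsZ.
exact: (hf _).2.
Unshelve. all: by end_near. Qed.

Lemma avg_dist N j phi f g z (b : R) : (forall x, normc x = 1 -> normc (phi x) = 1) ->
  (forall x, normc x = 1 -> rnorm (f (rot j x z) - g (rot j x z)) <= b) ->
  rnorm (avg N j phi f z - avg N j phi g z) <= b.
Proof.
move=> phi1 H; rewrite /avg -cmeanB; apply: cmean_le => x x1.
by rewrite -scalerBr rnormZ phi1// mul1r H.
Qed.

(** The averages against x^l and x^-l are bounded by the sup of the function on a circle, so a
    uniform error e' changes the quantity that should vanish by at most (1 + |z_j|^l) e', whatever
    [N] is. *)
Lemma holo_limit j (g_ : nat -> X -> Y) f :
  (forall (M e : R), 0 < e -> exists k, forall z, polydisc M z -> rnorm (f z - g_ k z) <= e) ->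
  (forall k, holo j (g_ k)) -> holo j f.
Proof.
(* The radius is at least 1 so that the polydisc also contains the unit circle of comparison,
   through [upd z j 1]. *)
move=> fg hg z; have [M M1 Mz] := polydisc_exists z.
have Xp l x : normc x = 1 -> normc (x ^+ l) = 1 by move=> x1; rewrite normcX x1 expr1n.
have Xn l x : normc x = 1 -> normc (x ^- l) = 1 by move=> x1; rewrite normcV Xp// invr1.
split=> l; last first.
  move=> l0 e e0; have e2 : 0 < e / 2 by rewrite divr_gt0.
  have [k Hk] := fg M _ e2; have := (hg k z).2 l l0 _ e2.
  apply: filterS => N; rewrite !subr0 => HN.
  rewrite (le_lt_trans (rnorm_le_dist _ (avg N j (fun x => x ^+ l) (g_ k) z)))//.
  have : rnorm (avg N j (fun x => x ^+ l) f z - avg N j (fun x => x ^+ l) (g_ k) z) <= e / 2.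
    by apply: avg_dist => [x|x x1]; [exact: Xp|apply: Hk; exact: polydisc_rot].
  by move=> /(ltr_leD HN); rewrite -splitr.
move=> e e0; set w := normc (z 0 j) ^+ l.
have w0 : 0 <= w by rewrite exprn_ge0// normc_ge0.
have w1 : 0 < w + 1 by rewrite ltr_wpDl.
have e2 : 0 < e / 2 by rewrite divr_gt0.
have e3 : 0 < e / 2 / (w + 1) by rewrite divr_gt0.
have [k Hk] := fg M _ e3; have := (hg k z).1 l _ e2.
apply: filterS => N; rewrite !subr0.
set a := avg N j _ (g_ k) z; set b := avg N j _ (g_ k) _.
set a' := avg N j _ f z; set b' := avg N j _ f _ => HN.
rewrite (le_lt_trans (rnorm_le_dist _ (a - z 0 j ^+ l *: b)))//.
have Ha : rnorm (a' - a) <= e / 2 / (w + 1).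
  by apply: avg_dist => [x|x x1]; [exact: Xn|apply: Hk; exact: polydisc_rot].
have Hb : rnorm (b' - b) <= e / 2 / (w + 1).
  apply: avg_dist => [x|x x1]; [exact: Xn|apply: Hk; apply: polydisc_rot => //].
  exact: polydisc_upd1.
suff /(ltr_leD HN) : rnorm (a' - z 0 j ^+ l *: b' - (a - z 0 j ^+ l *: b)) <= e / 2.
  by rewrite -splitr.
have -> : a' - z 0 j ^+ l *: b' - (a - z 0 j ^+ l *: b) =
    (a' - a) - z 0 j ^+ l *: (b' - b) by rewrite scalerBr opprD addrACA -opprD.
rewrite (le_trans (rnormB _ _))// rnormZ normcX -/w.
apply: (@le_trans _ _ (e / 2 / (w + 1) + w * (e / 2 / (w + 1)))).
  by rewrite lerD// ler_wpM2l.
by rewrite -{1}[e / 2 / (w + 1)]mul1r -mulrDl addrC mulrC divfK// gt_eqF.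
Qed.

Lemma holo_fejer_mean n i j f : i != j -> tame f -> holo i f ->
  holo i (fejer_mean n j f).
Proof.
move=> ij tf hf; apply: (@holo_limit _ (fun N => fejer_avg N n j f)).
  move=> M e e0; have [N0 H] := fejer_mean_unif n j M tf e0.
  by exists N0 => z Mz; rewrite rnorm_distC; exact: H.
by move=> k; exact: holo_avg.
Qed.

(* [f] is a polynomial of degree less than [2 ^ q] in the variable [j]: it is
   recovered from its values at the [2 ^ q]-th roots of unity. *)
Definition pol q j f := forall z, f z =
  \sum_(0 <= l < 2 ^ q) z 0 j ^+ l *: cmean q (fun x => x ^- l *: f (upd z j x)).

(** For a fixed [q], [pol] is an identity between finite combinations of values of the function, so
    it survives pointwise limits. *)
Lemma pol_limit q j (g_ : nat -> X -> Y) f : (forall z, tends (g_ ^~ z) (f z)) ->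
  (forall N, pol q j (g_ N)) -> pol q j f.
Proof.
move=> gf pg z; apply: tends_unique (gf z) _.
have : tends (fun N => \sum_(0 <= l < 2 ^ q) z 0 j ^+ l *:
    cmean q (fun x => x ^- l *: g_ N (upd z j x)))
  (\sum_(0 <= l < 2 ^ q) z 0 j ^+ l *: cmean q (fun x => x ^- l *: f (upd z j x))).
  apply: tends_sum => l; apply: tendsZ; apply: tends_cmean => x; apply: tendsZ.
  exact: gf.
by apply: tends_eq; near=> N; rewrite -pg.
Unshelve. all: by end_near. Qed.

Lemma pol_avg q N i j phi f : i != j -> pol q i f -> pol q i (avg N j phi f).
Proof.
move=> ij pf z; rewrite {1}/avg.
rewrite (eq_cmean _ (F' := fun x => \sum_(0 <= l < 2 ^ q)
   z 0 i ^+ l *: cmean q (fun y => y ^- l *: (phi x *: f (rot j x (upd z i y)))))).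
  rewrite cmean_sum; apply: eq_bigr => l _; rewrite cmeanZ cmean_exchange.
  by congr (_ *: _); apply: eq_cmean => y _; rewrite cmeanZ.
move=> x _; rewrite pf scaler_sumr; apply: eq_bigr => l _.
rewrite rot_coord// scalerA mulrC -scalerA; congr (_ *: _).
rewrite -cmeanZ; apply: eq_cmean => y _.
by rewrite upd_rotC// !scalerA mulrC.
Qed.

Lemma pol_fejer_mean_other q n i j f : i != j -> tame f -> pol q i f ->
  pol q i (fejer_mean n j f).
Proof.
move=> ij tf pf; apply: (@pol_limit _ _ (fun N => fejer_avg N n j f)).
  by move=> z; exact: fejer_mean_tends.
by move=> N; exact: pol_avg.
Qed.

Lemma polZ q j a f : pol q j f -> pol q j (fun z => a *: f z).
Proof.
move=> pf z; rewrite pf scaler_sumr; apply: eq_bigr => l _.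
rewrite scalerA mulrC -scalerA; congr (_ *: _).
rewrite -cmeanZ; apply: eq_cmean => x _.
by rewrite !scalerA mulrC.
Qed.

Lemma pol_sum q j (I : Type) (s : seq I) (F : I -> X -> Y) :
  (forall k, pol q j (F k)) -> pol q j (fun z => \sum_(k <- s) F k z).
Proof.
move=> pF z; rewrite (eq_bigr _ (fun k _ => pF k z)) exchange_big/=.
apply: eq_bigr => l _; rewrite -scaler_sumr -cmean_sum; congr (_ *: _).
by apply: eq_cmean => x _; rewrite scaler_sumr.
Qed.

(** Orthogonality of powers of degree less than 2^q. Evaluating [c] at [upd z j 1] is the way to
    express a coefficient free of the variable [j]. *)
Lemma pol_monomial q j l (c : X -> Y) : (l < 2 ^ q)%N ->
  pol q j (fun z => z 0 j ^+ l *: c (upd z j 1)).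
Proof.
move=> lq z.
rewrite (bigD1_seq l) ?iota_uniq ?mem_index_iota//= [X in _ + X]big1_seq ?addr0.
  congr (_ *: _); rewrite (eq_cmean _ (F' := fun=> c (upd z j 1))) ?cmean_cst// => x x1.
  rewrite updE eqxx upd_upd scalerA mulVf ?scale1r// expf_neq0//.
  by rewrite -normc_eq0 x1 oner_neq0.
move=> k /andP[kl]; rewrite mem_index_iota => /andP[_ kq].
rewrite (eq_cmean _ (F' := fun x => (x ^+ l * x ^- k) *: c (upd z j 1))); last first.
  by move=> x _; rewrite updE eqxx upd_upd scalerA mulrC.
have [lk|kl'|lk] := ltngtP l k; last by rewrite lk eqxx in kl.
  rewrite (eq_cmean _ (F' := fun x => x ^- (k - l) *: c (upd z j 1))); last first.
    by move=> x x1; rewrite unit_mulXV// leqNgt lk.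
  by rewrite cmeanV0 ?scaler0//; lia.
rewrite (eq_cmean _ (F' := fun x => x ^+ (l - k) *: c (upd z j 1))); last first.
  by move=> x x1; rewrite unit_mulXV// ltnW.
by rewrite cmeanX0 ?scaler0//; lia.
Qed.

(** Expanding the kernel, the terms with a <= b are asymptotic to monomials of degree b - a and the
    others tend to 0. The coefficients of the polynomials [p N] are not shown to converge: it is
    enough that [p N] and the Fejer average differ by o(1). *)
Lemma pol_fejer_mean q n j f : (0 < n <= 2 ^ q)%N -> tame f -> holo j f ->
  pol q j (fejer_mean n j f).
Proof.
move=> /andP[n0 nq] tf hf.
pose t N a b z : Y := if (a <= b)%N then z 0 j ^+ (b - a) *:
  avg N j (fun x => x ^- (b - a)) f (upd z j 1) else 0.
pose p N z : Y := n%:R^-1 *: \sum_(0 <= a < n) \sum_(0 <= b < n) t N a b z.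
have pol0 : pol q j (fun=> 0 : Y).
  have := @pol_monomial q j 0 (fun=> 0) ; rewrite expn_gt0 => /(_ isT) H z.
  by have := H z; under eq_bigr do under eq_cmean do rewrite scaler0; rewrite scaler0.
(* [pol_sum] asks for all indices, so the terms with b >= n, whose degree is not controlled, are
   replaced by zero. *)
pose t' N a b z : Y := if (b < n)%N then t N a b z else 0.
have pp N : pol q j (p N).
  have -> : p N = fun z => n%:R^-1 *: \sum_(0 <= a < n) \sum_(0 <= b < n) t' N a b z.
    apply/funext => z; congr (_ *: _); apply: eq_bigr => a _.
    by rewrite big_nat [RHS]big_nat; apply: eq_bigr => b /andP[_ bn]; rewrite /t' bn.
  apply: polZ; apply: pol_sum => a; apply: pol_sum => b.
  have [/andP[bn ab]|bab] := boolP ((b < n) && (a <= b))%N; last first.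
    suff -> : t' N a b = fun=> 0 by [].
    apply/funext => z; rewrite /t' /t; move: bab.
    by rewrite negb_and => /orP[|] /negbTE ->//; case: ifP.
  have -> : t' N a b = fun z => z 0 j ^+ (b - a) *:
      avg N j (fun x => x ^- (b - a)) f (upd z j 1).
    by apply/funext => z; rewrite /t' /t bn ab.
  apply: (@pol_monomial q j (b - a) (fun z => avg N j (fun x => x ^- (b - a)) f z)).
  by rewrite (leq_ltn_trans (leq_subr _ _))// (leq_trans bn).
apply: (pol_limit _ pp) => z.
have E N : fejer_avg N n j f z = n%:R^-1 *: \sum_(0 <= a < n) \sum_(0 <= b < n)
    avg N j (fun x => x ^+ a * x ^- b) f z.
  rewrite /fejer_avg /avg.
  under eq_bigr do rewrite -cmean_sum.
  rewrite -cmean_sum -cmeanZ; apply: eq_cmean => x x1.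
  rewrite fejerE// -scalerA; congr (_ *: _); rewrite scaler_suml.
  by apply: eq_bigr => a _; rewrite scaler_suml.
have D a b : tends (fun N => avg N j (fun x => x ^+ a * x ^- b) f z - t N a b z) 0.
  rewrite /t; have [ab|ba] := leqP a b.
    have := (hf z).1 (b - a)%N; apply: tends_eq; near=> N; congr (_ - _).
    apply: eq_cmean => x x1; rewrite unit_mulXV//; case: leqP => // ba.
    have -> : (b = a)%N by apply/eqP; rewrite eqn_leq ba ab.
    by rewrite subnn expr0 invr1.
  have := (hf z).2 (a - b)%N; rewrite subn_gt0 => /(_ ba); apply: tends_eq; near=> N.
  by rewrite subr0; apply: eq_cmean => x x1; rewrite unit_mulXV// ltnW.
have DD : tends (fun N => fejer_avg N n j f z - p N z) 0.
  have := tendsZ n%:R^-1 (tends_sum (index_iota 0 n) (fun a =>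
    tends_sum (index_iota 0 n) (D a))).
  rewrite big1 ?scaler0 => [|a _]; last by rewrite big1.
  apply: tends_eq; near=> N; rewrite E /p -scalerBr -sumrB; congr (_ *: _).
  by apply: eq_bigr => a _; rewrite sumrB.
have := tendsB (fejer_mean_tends n j z tf) DD; rewrite subr0.
by apply: tends_eq; near=> N; rewrite subKr.
Unshelve. all: by end_near. Qed.

End coordinatewise_polynomials.

(** * From differentiability on C^d to [cdiff] and [tame] *)

Section entire_functions.
Context {R : realType} {d : nat} {Y : completeNormedModType R[i]}.
Local Notation C := (R[i] : numFieldType).
Local Notation X := 'rV[C]_d.
Implicit Types (f g : X -> Y) (z : X) (i j : 'I_d) (x y : C).

Lemma nbhs_rowP z (A : set X) : nbhs z A <->
  exists2 r : R, 0 < r & forall z', (forall i, normc (z 0 i - z' 0 i) < r) -> A z'.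
Proof.
split=> [/nbhs_ballP[e /= e0 eA]|[r r0 rA]].
  move: (e0); rewrite ltcE/= => /andP[/eqP ei er].
  exists (complex.Re e) => // z' zz'; apply: eA; split=> // i k.
  rewrite -ball_normE /ball_/= normcE ltcE/= ei eqxx/=.
  by rewrite (ord1 i).
apply/nbhs_ballP; exists r%:C; first by rewrite /= ltcR.
move=> z' [_ /= zz']; apply: rA => i; have := zz' 0 i.
by rewrite -ball_normE/ball_/= normcE ltcR.
Qed.

Lemma upd_shift z j x y : upd z j (x + y) = upd z j x + y *: delta_mx 0 j.
Proof.
apply/rowP => i; rewrite updE !mxE eqxx /=; case: eqP => _; rewrite ?mulr1//.
by rewrite mulr0 addr0.
Qed.

Lemma entire_cdiff f j z : entire f -> cdiff (fun x => f (upd z j x)).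
Proof.
move=> df w; pose z0 : X := upd z j w; exists ('d f z0 (delta_mx 0 j)) => e e0.
have /diff_locallyxP[_ dfz] := df z0.
pose K : R := complex.Re `|delta_mx 0 j : X|.
have KE : `|delta_mx 0 j : X| = K%:C.
  rewrite /K; have := normr_ge0 (delta_mx 0 j : X); case: `|_| => a b.
  by rewrite lecE/= => /andP[/eqP -> _].
have K0 : 0 <= K by rewrite -lecR -KE normr_ge0.
have K1 : 0 < K + 1 by rewrite ltr_wpDl.
have : (fun h => f (h + z0) - f z0 - 'd f z0 h) =o_ (0 : X) id.
  apply/eqoP => e' e'0; near=> h; rewrite dfz -addrA -opprD [f z0 + _ + _]addrC addrK.
  by near: h; apply: littleoP.
move=> /eqoP /(_ (e / (K + 1))%:C); rewrite ltcR divr_gt0// => /(_ isT).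
move=> /nbhs_rowP[r r0 H]; exists r => // h hr.
have := H (h *: delta_mx 0 j); rewrite /= linearZ/= [_ + z0]addrC -upd_shift.
rewrite -/z0 normrZ KE rnormE normcE -!rmorphM/= lecR => H'.
rewrite (le_trans (H' _))//.
  move=> i; rewrite !mxE sub0r normcN eqxx/=; case: eqP => _; rewrite ?mulr1// mulr0.
  by rewrite normc0.
rewrite mulrCA mulrC ler_wpM2r ?normc_ge0// mulrAC ler_pdivrMr//.
by rewrite ler_wpM2l ?(ltW e0)// lerDl.
Unshelve. all: by end_near. Qed.

(** A square rather than a disc: it contains the disc of radius [M], and its compactness comes from
    that of a product of two real segments. *)
Definition square (M : R) : set C :=
  [set x | `|complex.Re x| <= M /\ `|complex.Im x| <= M].

Lemma compact_square (M : R) : compact (square M).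
Proof.
pose phi (p : R * R) : C := p.1 +i* p.2.
have -> : square M = phi @` (`[- M, M] `*` `[- M, M]).
  apply/seteqP; split=> [[a b] [/= aM bM]|_ [[a b] [/= aM bM] <-]].
    exists (a, b) => //; split; rewrite /= in_itv/= -ler_norml//.
  by move: aM bM; rewrite /square/= !in_itv/= -!ler_norml.
apply: continuous_compact; last by apply: compact_setX; exact: segment_compact.
apply: continuous_subspaceT => -[a b].
move=> A /nbhs_ballP[e /= e0 eA].
move: (e0); rewrite ltcE/= => /andP[/eqP ei er].
have e2 : 0 < complex.Re e / 2 by rewrite divr_gt0.
near=> p; apply: eA; rewrite -ball_normE/ball_/= normcE ltcE/= ei eqxx/=.
rewrite (le_lt_trans (normc_le_ReIm _))//= [ltRHS]splitr.
apply: ltrD; near: p.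
  have : \forall p \near (a, b), ball (a, b) (complex.Re e / 2) p by exact: nbhsx_ballx.
  by apply: filterS => p [].
have : \forall p \near (a, b), ball (a, b) (complex.Re e / 2) p by exact: nbhsx_ballx.
by apply: filterS => p [].
Unshelve. all: by end_near. Qed.

(** Two near-covering arguments on a product of squares: along [+oo] for the bound, along [0^'+] for
    the modulus of continuity. In the second, radii are halved so that a point close to [z'] is
    still close to [z]. *)
Lemma entire_tame f : entire f -> tame f.
Proof.
move=> df; have cf z (e : R) : 0 < e -> exists2 r : R, 0 < r & forall z',
    (forall i, normc (z 0 i - z' 0 i) < r) -> rnorm (f z - f z') < e.
  move=> e0; have /differentiable_continuous/cvgrPdist_lt := df z.
  move=> /(_ e%:C); rewrite ltcR => /(_ e0)/nbhs_rowP[r r0 H].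
  by exists r => // z' /H; rewrite /= rnormE ltcR.
have cK (M : R) : compact [set z : X | forall i, square M (z 0 i)].
  by apply: (@rV_compact C d (fun=> square M)) => i; exact: compact_square.
have PK (M : R) z : polydisc M z -> forall i, square M (z 0 i).
  by move=> Mz i; split; rewrite (le_trans _ (Mz i))// ?normc_Re ?normc_Im.
split=> [M|M e e0].
  have /compact_near_coveringP := cK M.
  move=> /(_ R (pinfty_nbhs R) (fun C z => rnorm (f z) <= C) _) H.
  have : \forall C \near +oo, [set z : X | forall i, square M (z 0 i)] `<=`
      (fun z => rnorm (f z) <= C).
    apply: H => z _; have [r r0 Hr] := cf z 1 ltr01.
    exists ([set z' : X | forall i, normc (z 0 i - z' 0 i) < r],
            [set C | rnorm (f z) + 1 <= C]) => /=.
      split; first by apply/nbhs_rowP; exists r.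
      by apply: nbhs_pinfty_ge; rewrite num_real.
    move=> [z' C] [/= /Hr zz' zC].
    rewrite (le_trans _ zC)// (le_trans (rnorm_le_dist _ (f z)))// lerD2l.
    by rewrite rnorm_distC ltW.
  by move=> /filter_ex[C HC]; exists C => z /PK; exact: HC.
have /compact_near_coveringP := cK M.
move=> /(_ R (0 : R)^'+ (fun del z => forall z', (forall i, normc (z 0 i - z' 0 i) < del) ->
  rnorm (f z - f z') <= e) _) H.
have {}H : \forall del \near 0^'+, [set z : X | forall i, square M (z 0 i)] `<=`
   (fun z => forall z', (forall i, normc (z 0 i - z' 0 i) < del) ->
  rnorm (f z - f z') <= e).
  apply: H => z _; have e2 : 0 < e / 2 by rewrite divr_gt0.
  have [r r0 Hr] := cf z _ e2.
  have r2 : 0 < r / 2 by rewrite divr_gt0.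
  exists ([set z' : X | forall i, normc (z 0 i - z' 0 i) < r / 2],
          [set del | del < r / 2]) => /=.
    split; first by apply/nbhs_rowP; exists (r / 2).
    exact: nbhs_right_lt.
  move=> [z' del] [/= zz' dr] z'' zz''.
  rewrite (le_trans (rnorm_distD (f z) _ _))// rnorm_distC [leRHS]splitr.
  apply: lerD; apply/ltW/Hr => i.
    by rewrite (lt_le_trans (zz' i))// ler_pdivrMr// ler_pMr// ler1n.
  rewrite -(subrKA (z' 0 i)) (le_lt_trans (le_normcD _ _))// [ltRHS]splitr.
  by rewrite ltrD// (lt_trans (zz'' i)).
have [del [del0 Hd]] : exists del : R, 0 < del /\ [set z : X | forall i, square M (z 0 i)] `<=`
   (fun z => forall z', (forall i, normc (z 0 i - z' 0 i) < del) ->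
  rnorm (f z - f z') <= e).
  by apply: (filter_ex (filterI _ H)); exact: nbhs_right_gt.
by exists del => // z z' /PK zK _; exact: Hd.
Qed.

End entire_functions.

(** * From polynomials in each coordinate to polynomials in all of them *)

Section vector_polynomials.
Context {R : realType} {d : nat} {Y : completeNormedModType R[i]}.
Local Notation C := (R[i] : numFieldType).
Local Notation X := 'rV[C]_d.
Implicit Types (f g : X -> Y) (z : X) (i j : 'I_d) (x y : C).

Lemma entire_monomial (e : 'I_d -> nat) (b : Y) :
  entire (fun z : X => (\prod_i z 0 i ^+ e i) *: b).
Proof.
move=> z; apply: (@differentiableZl C X Y (fun z : X => \prod_i z 0 i ^+ e i)).
elim: (index_enum _) => [|i s ih].
  rewrite (_ : (fun _ => _) = cst (1 : C)); first exact: differentiable_cst.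
  by apply/funext => ?; rewrite big_nil.
rewrite (_ : (fun _ => _) = (fun z : X => z 0 i ^+ e i : C) *
    (fun z : X => \prod_(k <- s) z 0 k ^+ e k)); last first.
  by apply/funext => w; rewrite big_cons.
apply: differentiableM => //; elim: (e i) => [|k ihk].
  exact: (differentiable_cst (1 : C)).
rewrite (_ : (fun _ => _) = (fun z : X => z 0 i : C) * (fun z : X => z 0 i ^+ k)).
  by apply: differentiableM => //; exact: differentiable_coord.
by apply/funext => w; rewrite exprS.
Qed.

Lemma entireD f g : entire f -> entire g -> entire (fun z => f z + g z).
Proof. by move=> df dg z; exact: differentiableD. Qed.

Lemma entire_vpolynomial f : vpolynomial f -> entire f.
Proof.
move=> [N [a fE]].
have -> : f = fun z => \sum_(alpha : {ffun 'I_d -> 'I_N})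
      (\prod_(i < d) z 0 i ^+ alpha i) *: a alpha by apply/funext.
elim: (index_enum _) => [|al s ih].
  rewrite (_ : (fun _ => _) = fun=> 0); first by move=> z; exact: differentiable_cst.
  by apply/funext => ?; rewrite big_nil.
rewrite (_ : (fun _ => _) = fun z => (\prod_(i < d) z 0 i ^+ al i) *: a al +
  \sum_(alpha <- s) (\prod_(i < d) z 0 i ^+ alpha i) *: a alpha).
  by apply: entireD => //; exact: (entire_monomial (fun i => al i)).
by apply/funext => ?; rewrite big_cons.
Qed.

(** Lists with unbounded exponents make sums a concatenation; the common bound on exponents that
    [vpolynomial] requires is extracted only once. *)
Definition monomial_sum f := exists s : seq (('I_d -> nat) * Y), forall z,
  f z = \sum_(t <- s) (\prod_(i < d) z 0 i ^+ t.1 i) *: t.2.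

Lemma vpolynomial_monomial_sum f : monomial_sum f -> vpolynomial f.
Proof.
move=> [s fE].
pose Nbnd (N : nat) (s : seq (('I_d -> nat) * Y)) := all (fun t => [forall i, t.1 i < N]%N) s.
have [N sN] : exists N, Nbnd N s.
  elim: s {fE} => [|[e b] s [N sN]]; first by exists 0%N.
  exists (maxn N (\max_i e i).+1); rewrite /Nbnd/=; apply/andP; split.
    by apply/forallP => i; rewrite leq_max ltnS leq_bigmax orbT.
  apply: sub_all sN => t /forallP H; apply/forallP => i.
  by rewrite leq_max H.
exists N; suff [a Ha] : exists a : {ffun 'I_d -> 'I_N} -> Y, forall z,
    \sum_(t <- s) (\prod_(i < d) z 0 i ^+ t.1 i) *: t.2 =
    \sum_(alpha : {ffun 'I_d -> 'I_N}) (\prod_(i < d) z 0 i ^+ alpha i) *: a alpha.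
  by exists a => z; rewrite fE Ha.
elim: s sN {fE} => [_|[e b] s ih /= /andP[/forallP eN /ih[a Ha]]].
  by exists (fun=> 0) => z; rewrite big_nil big1// => al _; rewrite scaler0.
pose al0 : {ffun 'I_d -> 'I_N} := [ffun i => Ordinal (eN i)].
exists (fun al => (if al == al0 then b else 0) + a al) => z.
rewrite big_cons Ha; under [RHS]eq_bigr do rewrite scalerDr.
rewrite big_split/=; congr (_ + _).
rewrite (bigD1 al0)//= eqxx [X in _ + X]big1 ?addr0 => [|al /negbTE ->]; last first.
  by rewrite scaler0.
by congr (_ *: _); apply: eq_bigr => i _; rewrite ffunE.
Qed.

Lemma monomial_sum_sum (I : Type) (s : seq I) (F : I -> X -> Y) :
  (forall k, monomial_sum (F k)) -> monomial_sum (fun z => \sum_(k <- s) F k z).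
Proof.
move=> HF; elim: s => [|k s [t tE]]; first by exists [::] => z; rewrite !big_nil.
have [t' tE'] := HF k; exists (t' ++ t) => z.
by rewrite big_cons big_cat/= tE tE'.
Qed.

Lemma monomial_sumX j l f : monomial_sum f -> monomial_sum (fun z => z 0 j ^+ l *: f z).
Proof.
move=> [s fE]; exists [seq ((fun i => t.1 i + (if i == j then l else 0))%N, t.2) | t <- s].
move=> z; rewrite fE big_map scaler_sumr; apply: eq_bigr => t _ /=.
rewrite scalerA; congr (_ *: _); under [RHS]eq_bigr do rewrite exprD.
rewrite big_split/= mulrC; congr (_ * _).
rewrite (bigD1 j)//= eqxx big1 ?mulr1// => i /negbTE ->.
by rewrite expr0.
Qed.

(** Induction on the set of variables on which [g] depends. Expanding in [j] produces coefficients
    that no longer depend on [j] and remain polynomial in every variable. *)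
Lemma pol_monomial_sum q f : (forall j, pol q j f) -> monomial_sum f.
Proof.
move=> pf.
suff H : forall s : seq 'I_d, uniq s -> forall g, (forall j, pol q j g) ->
    (forall z z', (forall i, i \in s -> z 0 i = z' 0 i) -> g z = g z') ->
    monomial_sum g.
  apply: (H (enum 'I_d)) => //; first exact: enum_uniq.
  move=> z z' zz'; congr f; apply/rowP => i; apply: zz'.
  by rewrite mem_enum.
elim=> [_ g _ gs|j s ih /= /andP[js us] g pg gs].
  exists [:: (fun=> 0%N, g 0)] => z; rewrite big_seq1/= big1 ?scale1r => [|i _].
    exact: gs.
  by rewrite expr0.
rewrite (_ : g = fun z => \sum_(0 <= l < 2 ^ q) z 0 j ^+ l *:
    cmean q (fun x => x ^- l *: g (upd z j x))); last first.
  by apply/funext => z; rewrite -pg.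
apply: monomial_sum_sum => l; apply: monomial_sumX.
pose c z : Y := cmean q (fun x => x ^- l *: g (upd z j x)).
rewrite -/c; apply: ih => //; last first.
  move=> z z' zz'; apply: eq_cmean => x _; congr (_ *: _); apply: gs => i.
  rewrite !updE in_cons; case: eqP => //= ij; exact: zz'.
move=> i; have [->|ij] := eqVneq i j.
  (* As [c] is constant in the variable [j], it is the degree zero case of [pol_monomial]. *)
  have cE z : c z = c (upd z j 1).
    by apply: eq_cmean => x _; rewrite upd_upd.
  have := @pol_monomial R d Y q j 0 c; rewrite expn_gt0 => /(_ isT) H z.
  have := H z; rewrite expr0 scale1r -cE => ->.
  apply: eq_bigr => k _; congr (_ *: _); apply: eq_cmean => x _.
  by rewrite expr0 scale1r -cE.
move=> z; rewrite {1}/c.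
rewrite (eq_cmean _ (F' := fun x => \sum_(0 <= k < 2 ^ q) z 0 i ^+ k *:
   cmean q (fun y => (x ^- l * y ^- k) *: g (upd (upd z j x) i y)))).
  rewrite cmean_sum; apply: eq_bigr => k _; rewrite cmeanZ cmean_exchange.
  congr (_ *: _); apply: eq_cmean => y _; rewrite -cmeanZ; apply: eq_cmean => x _.
  by rewrite scalerA mulrC updC// eq_sym.
move=> x _; rewrite (pg i) scaler_sumr; apply: eq_bigr => k _.
rewrite updE (negbTE ij) scalerA mulrC -scalerA; congr (_ *: _).
by rewrite -cmeanZ; apply: eq_cmean => y _; rewrite scalerA.
Qed.

End vector_polynomials.

(** * Fejer means in all coordinates *)

Section iterated_fejer_means.
Context {R : realType} {d : nat} {Y : completeNormedModType R[i]}.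
Local Notation C := (R[i] : numFieldType).
Local Notation X := 'rV[C]_d.
Implicit Types (f g : X -> Y) (z : X) (i j : 'I_d) (x y : C).

Fixpoint fejer_iter n (s : seq 'I_d) f : X -> Y :=
  if s is j :: s' then fejer_mean n j (fejer_iter n s' f) else f.

Definition torus_fejer n f := fejer_iter n (enum 'I_d) f.

Lemma tame_fejer_iter n s f : (0 < n)%N -> tame f -> tame (fejer_iter n s f).
Proof. by move=> n0 tf; elim: s => //= j s; exact: tame_fejer_mean. Qed.

Lemma holo_fejer_iter n s f i : (0 < n)%N -> tame f -> holo i f -> i \notin s ->
  holo i (fejer_iter n s f).
Proof.
move=> n0 tf hf; elim: s => //= j s ih; rewrite in_cons negb_or => /andP[ij /ih].
by apply: holo_fejer_mean => //; exact: tame_fejer_iter.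
Qed.

(** When the mean in [i] is taken, [holo] in [i] is still available since no earlier mean concerned
    [i], by [uniq]; later means preserve [pol] in [i]. *)
Lemma pol_fejer_iter q n s f i : (0 < n <= 2 ^ q)%N -> tame f ->
  (forall j, holo j f) -> uniq s -> i \in s -> pol q i (fejer_iter n s f).
Proof.
move=> nq tf hf; have /andP[n0 _] := nq.
elim: s => //= j s ih /andP[js us]; rewrite in_cons.
have [->|ij] /= := eqVneq i j.
  by move=> _; apply: pol_fejer_mean => //; [exact: tame_fejer_iter|exact: holo_fejer_iter].
by move=> /(ih us) H; apply: pol_fejer_mean_other => //; exact: tame_fejer_iter.
Qed.

Lemma vpolynomial_torus_fejer n f : (0 < n)%N -> entire f ->
  vpolynomial (torus_fejer n f).
Proof.
move=> n0 df; have tf := entire_tame df.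
(* The degree parameter [q] is taken equal to [n], as n <= 2^n. *)
apply: vpolynomial_monomial_sum; apply: (@pol_monomial_sum _ _ _ n) => j.
apply: pol_fejer_iter => //; rewrite ?enum_uniq ?mem_enum//.
  by rewrite n0 ltnW// ltn_expl.
by move=> i; apply: holo_cdiff => z; exact: entire_cdiff.
Qed.

Lemma torus_fejer_le n f z (b : R) : (0 < n)%N -> tame f ->
  (forall z', (forall i, normc (z' 0 i) = normc (z 0 i)) -> rnorm (f z') <= b) ->
  rnorm (torus_fejer n f z) <= b.
Proof.
move=> n0 tf; rewrite /torus_fejer; elim: (enum _) z => /= [|j s ih] z H.
  exact: H.
apply: fejer_mean_le => //; first exact: tame_fejer_iter.
by move=> x x1; apply: ih => z' zz'; apply: H => i; rewrite zz' normc_rot.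
Qed.

(** The outer mean does not increase the error of the inner ones, and adds only its own. *)
Lemma torus_fejer_approx f (M e : R) : tame f -> 0 < e ->
  exists n0, forall n z, (n0 < n)%N -> polydisc M z ->
    rnorm (torus_fejer n f z - f z) <= e.
Proof.
rewrite /torus_fejer; elim: (enum _) e => /= [|j s ih] e tf e0.
  by exists 0%N => n z _ _; rewrite subrr rnorm0 ltW.
have e2 : 0 < e / 2 by rewrite divr_gt0.
have [n1 H1] := ih _ tf e2; have [n2 H2] := fejer_mean_approx j M tf e2.
exists (maxn n1 n2) => n z; rewrite gtn_max => /andP[nn1 nn2] Mz.
have n0 : (0 < n)%N by exact: leq_ltn_trans nn1.
rewrite (le_trans (rnorm_distD (fejer_mean n j f z) _ _))// [leRHS]splitr.
apply: lerD; last exact: H2.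
apply: fejer_mean_dist => //; first exact: tame_fejer_iter.
by move=> x x1; apply: H1 => //; exact: polydisc_rot.
Qed.

End iterated_fejer_means.

(** * Invariance of Lebesgue measure under rotation of a coordinate *)

Section measure_invariance.
Local Open Scope ereal_scope.

(** Stated on integrals of nonnegative functions rather than on sets, so that it composes at once
    and combines directly with Tonelli's theorem. *)
Definition integral_invariant {dT} {T : measurableType dT} {R : realType}
    (mu : {measure set T -> \bar R}) (phi : T -> T) :=
  measurable_fun setT phi /\ forall g : T -> \bar R, measurable_fun setT g ->
    (forall x, 0 <= g x) -> \int[mu]_x g (phi x) = \int[mu]_x g x.

Lemma integral_invariant_comp {dT} {T : measurableType dT} {R : realType}
    (mu : {measure set T -> \bar R}) phi psi :
  integral_invariant mu phi -> integral_invariant mu psi ->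
  integral_invariant mu (phi \o psi).
Proof.
move=> [mphi iphi] [mpsi ipsi]; split; first exact: measurableT_comp.
move=> g mg g0; rewrite -(iphi g)//; apply: (ipsi (g \o phi)) => [|x].
  exact: measurableT_comp.
exact: g0.
Qed.

Section tonelli.
Context {d1 d2} {T1 : measurableType d1} {T2 : measurableType d2} {R : realType}.
Variables (m1 : {sigma_finite_measure set T1 -> \bar R})
          (m2 : {sigma_finite_measure set T2 -> \bar R}).
Variable f : T1 * T2 -> \bar R.
Hypothesis mf : measurable_fun setT f.
Hypothesis f0 : forall x, 0 <= f x.

Lemma tonelli1 : \int[sf_product m1 m2]_z f z = \int[m1]_x \int[m2]_y f (x, y).
Proof.
rewrite -[RHS](@fubini_tonelli1 _ _ _ _ _ m1 m2 f mf f0).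
exact: eq_measure_integral.
Qed.

Lemma tonelli2 : \int[sf_product m1 m2]_z f z = \int[m2]_y \int[m1]_x f (x, y).
Proof.
rewrite -[RHS](@fubini_tonelli2 _ _ _ _ _ m1 m2 f mf f0).
exact: eq_measure_integral.
Qed.

End tonelli.

Section plane.
Context {R : realType}.
Local Notation M := (measurableTypeR R).

Lemma integral_invariant_translation (a : R) :
  integral_invariant (@lebesgue_measure R) (fun x : M => (x + a)%R : M).
Proof.
have mt : measurable_fun setT (fun x : M => (x + a)%R : M).
  exact: measurable_funD.
split=> // g mg g0; pose nu : {measure set M -> \bar R} := pushforward (@lebesgue_measure R) (fun x : M => (x + a)%R : M).
have E A : measurable A -> lebesgue_measure A = pushforward (@lebesgue_measure R) (fun x : M => (x + a)%R : M) A.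
  apply: (@lebesgue_measure_unique R (nu mt)).
  move=> _ [[b c] _ <-]; rewrite /nu/= /pushforward.
  rewrite (_ : _ @^-1` _ = `](b - a)%R, (c - a)%R]%classic).
    rewrite !lebesgue_measure_itv/= !lte_fin ltrD2r; case: ifP => // _.
    by rewrite -!EFinD; congr EFin; ring.
  by apply/seteqP; split=> x /=; rewrite !in_itv/= ltrBlDr lerBrDr.
rewrite -[LHS](@ge0_integral_pushforward _ _ _ _ _ _ mt lebesgue_measure setT g)//.
by apply: eq_measure_integral => A mA _; apply/esym; exact: E.
Qed.

(** Integrating first in the sheared variable, the shear is a translation on each fibre. *)
Lemma integral_invariant_shear1 (a : R) :
  integral_invariant (lebesgue_plane R) (fun p : M * M => ((p.1 + a * p.2)%R : M, p.2 : M)).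
Proof.
have ms : measurable_fun setT (fun p : M * M => ((p.1 + a * p.2)%R : M, p.2 : M)).
  apply: measurable_fun_pair => //; apply: measurable_funD => //.
  exact: measurable_funM.
split=> // g mg g0; rewrite !tonelli2//; last exact: measurableT_comp.
apply: eq_integral => y _ /=.
have [_ /(_ (fun x => g (x, y)))] := integral_invariant_translation (a * y); apply=> //.
exact: measurableT_comp.
Qed.

Lemma integral_invariant_shear2 (a : R) :
  integral_invariant (lebesgue_plane R) (fun p : M * M => (p.1 : M, (p.2 + a * p.1)%R : M)).
Proof.
have ms : measurable_fun setT (fun p : M * M => (p.1 : M, (p.2 + a * p.1)%R : M)).
  apply: measurable_fun_pair => //; apply: measurable_funD => //.
  exact: measurable_funM.
split=> // g mg g0; rewrite !tonelli1//; last exact: measurableT_comp.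
apply: eq_integral => x _ /=.
have [_ /(_ (fun y => g (x, y)))] := integral_invariant_translation (a * x); apply=> //.
exact: measurableT_comp.
Qed.

Definition plane_rot (c s : R) (p : M * M) : M * M :=
  ((c * p.1 - s * p.2)%R, (s * p.1 + c * p.2)%R).

(* A rotation of angle different from [pi] is a product of three shears. *)
Lemma integral_invariant_plane_rot (c s : R) : (c ^+ 2 + s ^+ 2 = 1)%R ->
  integral_invariant (lebesgue_plane R) (plane_rot c s).
Proof.
have H (c' s' : R) : (c' ^+ 2 + s' ^+ 2 = 1)%R -> s' != 0%R ->
    integral_invariant (lebesgue_plane R) (plane_rot c' s').
  (* With c' = cos t and s' = sin t, this is - tan (t / 2), the slope of the first and third shears;
     the middle one has slope sin t. *)
  move=> cs s0; pose a := ((c' - 1) / s')%R.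
  have := integral_invariant_comp (integral_invariant_shear1 a)
    (integral_invariant_comp (integral_invariant_shear2 s') (integral_invariant_shear1 a)).
  congr integral_invariant; apply/funext => -[x y]; rewrite /plane_rot/=.
  have s2 : (s' * s' = 1 - c' * c')%R by rewrite -!expr2 -cs; ring.
  have as' : (a * s' = c' - 1)%R by rewrite /a divfK.
  have aa : (a * (1 + c') = - s')%R.
    apply: (mulIf s0); rewrite mulrAC as' mulNr s2; ring.
  congr pair; first last.
    transitivity ((1 + a * s') * y + s' * x)%R; first by ring.
    by rewrite as'; ring.
  transitivity ((1 + a * s') * x + (a * (1 + (1 + a * s'))) * y)%R; first by ring.
  by rewrite (_ : 1 + a * s' = c')%R ?aa ?as'; ring.
move=> cs; have [s0|] := eqVneq s 0%R; last exact: H.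
move: cs; rewrite s0 expr0n/= addr0 => /eqP; rewrite sqrf_eq1 => /orP[/eqP ->|/eqP ->].
  have -> : plane_rot 1 0 = id.
    by apply/funext => -[x y]; rewrite /plane_rot/= !mul1r !mul0r subr0 add0r.
  by split.
(* The half-turn has zero sine, so it is obtained as the square of the quarter-turn. *)
have H01 : integral_invariant (lebesgue_plane R) (plane_rot 0 1).
  by apply: H; rewrite ?oner_neq0// expr0n/= expr1n add0r.
have := integral_invariant_comp H01 H01; congr integral_invariant.
apply/funext => -[x y]; rewrite /plane_rot/=; congr pair; ring.
Qed.

End plane.

Section power.
Context {dT} {T : measurableType dT} {R : realType}.
Variable mu : {sigma_finite_measure set T -> \bar R}.

Definition tupd n (phi : T -> T) (j : 'I_n) (t : n.-tuple T) : n.-tuple T :=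
  [tuple if i == j then phi (tnth t i) else tnth t i | i < n].

Lemma measurable_tupd n phi (j : 'I_n) : measurable_fun setT phi ->
  measurable_fun setT (tupd phi j).
Proof.
move=> mphi; apply/measurable_fun_tnthP => i.
have [ij|ij] := eqVneq i j.
  rewrite (_ : _ \o _ = phi \o (fun t => tnth t i)).
    by apply: measurableT_comp => //; exact: measurable_tnth.
  by apply/funext => t /=; rewrite tnth_mktuple ij eqxx.
rewrite (_ : _ \o _ = (fun t => tnth t i)); first exact: measurable_tnth.
by apply/funext => t /=; rewrite tnth_mktuple (negbTE ij).
Qed.

Lemma integral_cons_measure n (g : n.+1.-tuple T -> \bar R) :
  measurable_fun setT g -> (forall t, 0 <= g t) ->
  \int[power_measure mu n.+1]_t g t =
  \int[sf_product mu (power_measure mu n)]_p g (tcons p).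
Proof.
move=> mg g0.
exact: (@ge0_integral_pushforward _ _ _ _ _ _ (@measurable_tcons _ _ n)
  (sf_product mu (power_measure mu n)) setT g).
Qed.

(** Induction on [n] through Tonelli's theorem: if [j] is the head, the head is integrated first;
    otherwise the tail is, by the induction hypothesis. *)
Lemma integral_invariant_tupd n phi (j : 'I_n) : integral_invariant mu phi ->
  integral_invariant (power_measure mu n) (tupd phi j).
Proof.
move=> iphi; have [mphi Hphi] := iphi; split; first exact: measurable_tupd.
elim: n j => [[]//|n ih] j g mg g0.
have mgc := measurableT_comp mg (@measurable_tcons _ T n).
rewrite !integral_cons_measure//; last first.
  by apply: measurableT_comp => //; exact: measurable_tupd.
have mgt : measurable_fun setT (fun p => g (tupd phi j (tcons p))).
  apply: (measurableT_comp mg); apply: (measurableT_comp (measurable_tupd j mphi)).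
  exact: measurable_tcons.
case: (unliftP ord0 j) => [k|] jE; last first.
- subst j; rewrite !tonelli2//=.
  apply: eq_integral => t _.
  have E x : tupd phi ord0 (tcons (x, t)) = tcons (phi x, t).
    apply: eq_from_tnth => i; rewrite tnth_mktuple.
    case: (unliftP ord0 i) => [k|] ->; last by rewrite eqxx !(tnth_nth x).
    by rewrite eq_sym (negbTE (neq_lift _ _)) !tnthS.
  under eq_integral do rewrite E.
  apply: (Hphi (fun x => g (tcons (x, t)))) => //.
  exact: (measurableT_comp mgc).
- rewrite !tonelli1//=.
  apply: eq_integral => x _.
  have E t : tupd phi j (tcons (x, t)) = tcons (x, tupd phi k t).
    apply: eq_from_tnth => i; rewrite tnth_mktuple jE.
    case: (unliftP ord0 i) => [l|] ->; last first.
      by rewrite (negbTE (neq_lift _ _)) !(tnth_nth x).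
    by rewrite !tnthS tnth_mktuple (inj_eq lift_inj).
  under eq_integral do rewrite E.
  apply: (ih k (fun t => g (tcons (x, t)))) => //.
  exact: (measurableT_comp mgc).
Qed.

End power.
End measure_invariance.

(** * Inequalities and continuity for real powers *)

Section real_powers.
Context {R : realType}.
Implicit Types (a b l p : R).

(* Jensen's inequality, from Young's inequality at [F x] and [s `^ (p - 1)]. *)
Lemma rmean_powR_le N (c F : R[i] -> R) p : 1 <= p -> (forall x, 0 <= c x) ->
  (forall x, 0 <= F x) -> rmean N c = 1 ->
  rmean N (fun x => c x * F x) `^ p <= rmean N (fun x => c x * F x `^ p).
Proof.
move=> p1 c0 F0 cN; set s := rmean N _.
have p0 : 0 < p by rewrite (lt_le_trans ltr01).
have rm0 G : (forall x, 0 <= G x) -> 0 <= rmean N G.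
  by move=> G0; rewrite /rmean mulr_ge0 ?invr_ge0 ?exprn_ge0// sumr_ge0.
have s0 : 0 <= s by apply: rm0 => x; rewrite mulr_ge0.
(* The exponent 1 is set apart because the conjugate exponent [q] is finite only for p > 1. *)
have [->|pn1] := eqVneq p 1.
  rewrite powRr1// /s le_eqVlt; apply/orP; left; apply/eqP; congr rmean.
  by apply/funext => x; rewrite powRr1.
have p1' : 1 < p by rewrite lt_neqAle eq_sym pn1.
pose q := p / (p - 1).
have pm0 : 0 < p - 1 by rewrite subr_gt0.
have q0 : 0 < q by rewrite divr_gt0.
have pq : p^-1 + q^-1 = 1 by rewrite /q; field; rewrite !gt_eqF.
have young x : c x * F x * s `^ (p - 1) <= c x * F x `^ p * p^-1 + c x * (s `^ p / q).
  have := conjugate_powR (F0 x) (powR_ge0 s (p - 1)) p0 q0 pq.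
  rewrite -powRrM (_ : (p - 1) * q = p) => [H|]; last by rewrite /q mulrC divfK ?gt_eqF.
  by rewrite -!mulrA -mulrDr ler_wpM2l.
(* Averaged, the left side becomes s * s^(p - 1) = s^p and the right side the mean divided by [p]
   plus s^p / q; then 1 - 1/q = 1/p. *)
have := @ler_rmean R N _ _ (fun x _ => young x).
rewrite rmeanD !rmeanMr cN mul1r -/s mulr_powRB1// => H.
rewrite -(ler_pM2r (_ : 0 < p^-1)) ?invr_gt0//.
have -> : p^-1 = 1 - q^-1 by rewrite -pq addrK.
by rewrite mulrBr mulr1 lerBlDr (_ : 1 - q^-1 = p^-1) // -pq addrK.
Qed.

(** The case of two nodes, the square roots of unity, with the value [a] at 1 and [b] at -1. *)
Lemma powR_mean2 a b p : 1 <= p -> 0 <= a -> 0 <= b ->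
  ((a + b) / 2) `^ p <= (a `^ p + b `^ p) / 2.
Proof.
move=> p1 a0 b0.
have := @rmean_powR_le 1 (fun=> 1) (fun x => if x == 1 then a else b) p p1.
rewrite rmean_cst => /(_ (fun=> ler01) _ erefl).
have u1 : (unity (2 ^ 1) : R[i]) ^+ 1 == 1 = false by apply/negbTE; exact: unityX_neq1.
rewrite /rmean (_ : 2 ^ 1 = 2)%N// !big_nat_recr//= !big_nil !add0r !expr0 !eqxx.
rewrite u1 !mul1r expr1 !(mulrC 2^-1); apply.
by move=> x; case: ifP.
Qed.

(** The constant is 2^(p - 1), which comes from convexity at the midpoint. *)
Lemma powR_dist_le a b c p : 1 <= p -> 0 <= a -> 0 <= b -> 0 <= c -> c <= a + b ->
  c `^ p <= 2 `^ p / 2 * (a `^ p + b `^ p).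
Proof.
move=> p1 a0 b0 c0 cab; have p0 : 0 <= p by rewrite (le_trans ler01).
have ab0 : 0 <= (a + b) / 2 by rewrite divr_ge0// addr_ge0.
rewrite (le_trans (ge0_ler_powR p0 _ _ cab)) ?nnegrE ?addr_ge0//.
rewrite (_ : a + b = 2 * ((a + b) / 2)); last by field.
by rewrite powRM// -mulrA ler_wpM2l ?powR_ge0// [leRHS]mulrC powR_mean2.
Qed.

Lemma cvg_powR (u : nat -> R) l p : 0 < p -> (forall n, 0 <= u n) ->
  u @ \oo --> l -> u n `^ p @[n --> \oo] --> l `^ p.
Proof.
move=> p0 u0 ul.
have l0 : 0 <= l.
  rewrite leNgt; apply/negP => l0; have /cvgrPdist_lt/(_ (- l)) := ul.
  rewrite oppr_gt0 => /(_ l0)/filter_ex[n]; rewrite ltr_norml opprK => /andP[+ _].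
  by rewrite ltrDl oppr_gt0 ltNge u0.
have [l0'|] := eqVneq l 0; last first.
  move=> ln0; have lp : l \in `]0, +oo[ by rewrite in_itv/= andbT lt_neqAle eq_sym ln0.
  have /derivable1_diffP/differentiable_continuous := @derivable_powR R 1 p l lp.
  by move=> /(cvg_comp _ _ ul).
(* At the limit 0 the power need not be differentiable, so epsilons are chosen by hand. *)
move: ul; rewrite l0' powR0 ?gt_eqF// => /cvgrPdist_lt ul.
apply/cvgrPdist_lt => e e0; have e1 : 0 < e `^ p^-1 by rewrite powR_gt0.
apply: filterS (ul _ e1) => n; rewrite !sub0r !normrN !ger0_norm ?powR_ge0// => ue.
have pn0 : p != 0 by rewrite gt_eqF.
rewrite -[ltRHS]powRr1 ?(ltW e0)// -(mulVf pn0).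
by rewrite powRrM gt0_ltr_powR// nnegrE// ltW.
Qed.

End real_powers.

(** * Measurability, norm decrease and convergence of the weighted integrals *)

Section fock_integrand.
Context {R : realType} {d : nat} {Y : completeNormedModType R[i]}.
Local Notation M := (measurableTypeR R).
Local Notation T := (M * M)%type.
Local Notation X := 'rV[R[i]]_d.
Implicit Types (t : d.-tuple T) (f : X -> Y).

Definition box (v : d.-tuple (rat * rat)) (c : R) : set (d.-tuple T) :=
  [set t | forall i, `|ratr (tnth v i).1 - (tnth t i).1| < c /\
                     `|ratr (tnth v i).2 - (tnth t i).2| < c].

Lemma measurable_box v c : measurable (box v c).
Proof.
have mb (q : R) : measurable ([set x | `|q - x| < c] : set M).
  rewrite (_ : mkset _ = `](q - c), (q + c)[%classic); first exact: measurable_itv.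
  by apply/seteqP; split=> x /=; rewrite in_itv/= ltr_distlC.
rewrite (_ : box v c = \bigcap_(i in [set: 'I_d]) ((fun t => tnth t i) @^-1`
   ([set x | `|ratr (tnth v i).1 - x| < c] `*` [set x | `|ratr (tnth v i).2 - x| < c]))).
  apply: fin_bigcap_measurable; first exact: finite_finset.
  move=> i _; rewrite -[X in measurable X]setTI; apply: measurable_tnth => //.
  exact: measurableX.
by apply/seteqP; split=> [t vt i _|t vt i]; [exact: vt|exact: (vt i I)].
Qed.

(** A set open for the sup distance is a countable union of boxes with rational centres and radii 1
    / (k + 1), each measurable for the product sigma-algebra. *)
Lemma measurable_open_tuple (S : set (d.-tuple T)) :
  (forall t, S t -> exists2 r : R, 0 < r & forall t',
    (forall i, `|(tnth t i).1 - (tnth t' i).1| < r /\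
               `|(tnth t i).2 - (tnth t' i).2| < r) -> S t') ->
  measurable S.
Proof.
move=> oS.
pose B (w : d.-tuple (rat * rat) * nat) := box w.1 w.2.+1%:R^-1.
rewrite (_ : S = \bigcup_w (if asbool (B w `<=` S) then B w else set0)).
  apply: countable_bigcupT_measurable; first exact: countableP.
  by move=> w; case: ifP => _; [exact: measurable_box|exact: measurable0].
apply/seteqP; split=> [t St|t [w _]]; last first.
  by case: ifPn => [/asboolP wS|_//]; exact: wS.
have [r r0 Hr] := oS t St.
(* The box radius is below r / 2, so a box that contains [t] lies within [r] of [t]. *)
pose k := Num.bound (2 / r).
have k0 : (0 : R) < k.+1%:R by rewrite ltr0n.
have kr : k.+1%:R^-1 < r / 2.
  rewrite -[r / 2]invrK ltf_pV2 ?posrE// ?invr_gt0 ?divr_gt0// invf_div.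
  by rewrite (lt_trans (archi_boundP _)) ?divr_ge0 ?(ltW r0)// ltr_nat.
have rat_near (x : R) : exists q : rat, `|ratr q - x| < k.+1%:R^-1.
  have [|q] := @rat_in_itvoo R (x - k.+1%:R^-1) (x + k.+1%:R^-1).
    by rewrite ltrBlDr -addrA ltrDl addr_gt0// invr_gt0.
  by move=> qx; exists q; rewrite distrC ltr_distlC; rewrite in_itv/= in qx.
pose v : d.-tuple (rat * rat) :=
  [tuple (sval (cid (rat_near (tnth t i).1)), sval (cid (rat_near (tnth t i).2))) | i < d].
have vt i : `|ratr (tnth v i).1 - (tnth t i).1| < k.+1%:R^-1 /\
            `|ratr (tnth v i).2 - (tnth t i).2| < k.+1%:R^-1.
  by rewrite tnth_mktuple/=; split; case: cid.
exists (v, k) => //; rewrite ifT//.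
apply/asboolP => t' vt'; apply: Hr => i; have [v1 v2] := vt i; have [w1 w2] := vt' i.
split.
  rewrite (le_lt_trans (ler_distD (ratr (tnth v i).1) _ _))// [ltRHS]splitr.
  by rewrite ltrD// ?(lt_trans _ kr)// distrC.
rewrite (le_lt_trans (ler_distD (ratr (tnth v i).2) _ _))// [ltRHS]splitr.
by rewrite ltrD// ?(lt_trans _ kr)// distrC.
Qed.

Lemma sqr_normcE (x : R[i]) : normc x ^+ 2 = complex.Re x ^+ 2 + complex.Im x ^+ 2.
Proof. by case: x => a b; rewrite /= sqr_sqrtr// addr_ge0 ?sqr_ge0. Qed.

Lemma euclidE (z : X) : euclid z = Num.sqrt (\sum_(i < d) normc (z 0 i) ^+ 2).
Proof. by congr Num.sqrt; apply: eq_bigr => i _; rewrite sqr_normcE. Qed.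

Lemma euclid_ge_coord (z : X) i : normc (z 0 i) <= euclid z.
Proof.
rewrite euclidE -[leLHS]ger0_norm ?normc_ge0// -sqrtr_sqr ler_wsqrtr//.
rewrite (bigD1 i)//= lerDl sumr_ge0// => k _; exact: sqr_ge0.
Qed.

Lemma weight_moduli (m beta : R) (z z' : X) :
  (forall i, normc (z 0 i) = normc (z' 0 i)) -> weight m beta z = weight m beta z'.
Proof.
by move=> zz'; rewrite /weight !euclidE; under eq_bigr do rewrite zz'.
Qed.

Lemma weight_gt0 (m beta : R) (z : X) : 0 < weight m beta z.
Proof. exact: expR_gt0. Qed.

Lemma tameB f g : tame f -> tame g -> tame (fun z => f z - g z).
Proof.
move=> [bf uf] [bg ug]; split=> [B|B e e0].
  have [C HC] := bf B; have [D HD] := bg B; exists (C + D) => z zB.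
  by rewrite (le_trans (rnormB _ _))// lerD ?HC ?HD.
have e2 : 0 < e / 2 by rewrite divr_gt0.
have [r r0 Hr] := uf B _ e2; have [s s0 Hs] := ug B _ e2.
exists (Num.min r s) => [|z z' zB z'B zz']; first by rewrite lt_min r0.
have -> : f z - g z - (f z' - g z') = (f z - f z') - (g z - g z').
  by rewrite opprD addrACA -opprD.
rewrite (le_trans (rnormB _ _))// [leRHS]splitr lerD//.
  by apply: Hr => // i; have := zz' i; rewrite lt_min => /andP[].
by apply: Hs => // i; have := zz' i; rewrite lt_min => /andP[].
Qed.

(** Continuity makes the superlevel sets open, and [measurable_open_tuple] applies. *)
Lemma measurable_tame f : tame f ->
  measurable_fun setT (fun t : d.-tuple T => rnorm (f (to_Cd t))).
Proof.
move=> [_ ucf] mT; apply: (measurability _ (RGenOInfty.measurableE R)) => //.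
move=> /= _ [_ [x ->] <-]; rewrite setTI.
apply: measurable_open_tuple => t /=; rewrite in_itv/= andbT => xt.
have [B B1 Bt] := polydisc_exists (to_Cd t).
have e0 : 0 < (rnorm (f (to_Cd t)) - x) / 2 by rewrite divr_gt0// subr_gt0.
have [r r0 Hr] := ucf (B + 1) _ e0.
(* A complex coordinate moves by less than [2 * r1], the sum over its real and imaginary parts: this
   must be at most [r], and at most 1 to remain in the polydisc of radius [B + 1]. *)
pose r1 : R := Num.min (r / 2) (1 / 2).
have r10 : 0 < r1 by rewrite lt_min !divr_gt0.
exists r1 => // t' tt'; rewrite /= in_itv/= andbT.
have dist i : normc (to_Cd t 0 i - to_Cd t' 0 i) < r1 + r1.
  rewrite (le_lt_trans (normc_le_ReIm _))// !mxE/=.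
  by have [h1 h2] := tt' i; exact: ltrD.
have r1r : r1 + r1 <= r.
  by rewrite [leRHS]splitr lerD// ge_min lexx.
have r11 : r1 + r1 <= 1.
  by rewrite [leRHS]splitr lerD// ge_min lexx orbT.
have := Hr (to_Cd t) (to_Cd t').
have P1 : polydisc (B + 1) (to_Cd t) by move=> i; rewrite (le_trans (Bt i))// lerDl.
have P2 : polydisc (B + 1) (to_Cd t').
  move=> i; rewrite -(subrK (to_Cd t 0 i) (to_Cd t' 0 i)) (le_trans (le_normcD _ _))//.
  by rewrite addrC lerD// normc_distC (le_trans (ltW (dist i))).
move=> /(_ P1 P2 (fun i => lt_le_trans (dist i) r1r)).
have := rnorm_le_dist (f (to_Cd t)) (f (to_Cd t')).
move: xt e0; set u := rnorm _; set v := rnorm _; set w := rnorm _; lra.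
Qed.

Lemma measurable_weight (m beta : R) :
  measurable_fun setT (fun t : d.-tuple T => weight m beta (to_Cd t)).
Proof.
rewrite /weight /euclid; apply: measurableT_comp => //; apply: measurable_funM => //.
apply: (measurableT_comp (@measurable_powR R _)).
have E (t : d.-tuple T) : Num.sqrt (\sum_(i < d) (complex.Re (to_Cd t 0 i) ^+ 2 +
    complex.Im (to_Cd t 0 i) ^+ 2)) =
  (\sum_(i < d) ((tnth t i).1 ^+ 2 + (tnth t i).2 ^+ 2)) `^ 2^-1.
  rewrite powR12_sqrt ?sumr_ge0// => [|i _]; last by rewrite addr_ge0 ?sqr_ge0.
  by congr Num.sqrt; apply: eq_bigr => i _; rewrite !mxE.
rewrite (eq_fun E); apply: (measurableT_comp (@measurable_powR R _)).
apply: measurable_sum => i; apply: measurable_funD; apply: measurable_funX.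
  apply: (measurableT_comp measurable_fst); exact: measurable_tnth.
apply: (measurableT_comp measurable_snd); exact: measurable_tnth.
Qed.

Section energy.
Variables (m beta p : R).
Hypothesis p_ge1 : 1 <= p.

Definition integrand f t : R := rnorm ((weight m beta (to_Cd t))%:C *: f (to_Cd t)) `^ p.

Definition energy f : \bar R := (\int[lebesgue_Cd R d]_t (integrand f t)%:E)%E.

Let p_gt0 : 0 < p. Proof. exact: lt_le_trans p_ge1. Qed.

Lemma integrand_ge0 f t : 0 <= integrand f t.
Proof. exact: powR_ge0. Qed.

Lemma measurable_integrand f : tame f -> measurable_fun setT (integrand f).
Proof.
move=> tf; apply: (measurableT_comp (@measurable_powR R _)).
rewrite (_ : (fun _ => _) = fun t : d.-tuple T => weight m beta (to_Cd t) * rnorm (f (to_Cd t))).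
  by apply: measurable_funM; [exact: measurable_weight|exact: measurable_tame].
by apply/funext => t; rewrite rnormZ normcR gtr0_norm// weight_gt0.
Qed.

Lemma to_Cd_rot j (x : R[i]) t :
  to_Cd (tupd (plane_rot (complex.Re x) (complex.Im x)) j t) = rot j x (to_Cd t).
Proof.
apply/rowP => i; rewrite updE !mxE tnth_mktuple; case: eqP => // ->.
by case: x => a b; apply/eqP; rewrite eq_complex /=; apply/andP; split; apply/eqP; ring.
Qed.

Lemma energy_rot j (x : R[i]) f : normc x = 1 -> tame f ->
  energy (fun z => f (rot j x z)) = energy f.
Proof.
move=> x1 tf; have xe : complex.Re x ^+ 2 + complex.Im x ^+ 2 = 1.
  by rewrite -sqr_normcE x1 expr1n.
have [_ H] := integral_invariant_tupd j (integral_invariant_plane_rot xe).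
have {}H := H (fun t => (integrand f t)%:E).
rewrite /energy -{}H; last 2 first.
- by apply/measurable_EFinP; exact: measurable_integrand.
- by move=> t; rewrite lee_fin integrand_ge0.
congr integral; apply/funext => t; congr EFin.
rewrite /integrand to_Cd_rot (@weight_moduli _ _ (rot j x (to_Cd t)) (to_Cd t))//.
by move=> i; rewrite normc_rot.
Qed.

Lemma tame_fejer_avg N n j f : (0 < n <= 2 ^ N)%N -> tame f ->
  tame (fejer_avg N n j f).
Proof.
move=> nN tf; have [bf ucf] := tf; split.
  move=> B; have [C HC] := bf B; exists C => z Bz.
  have := @fejer_avg_dist R d Y N n j f (fun=> 0) z z C nN.
  have -> : fejer_avg N n j (fun=> 0 : Y) z = 0.
    by rewrite /fejer_avg /avg; under eq_cmean do rewrite scaler0; exact: cmean_cst.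
  by rewrite subr0; apply => x x1; rewrite subr0; apply: HC; exact: polydisc_rot.
move=> B e e0; have [del del0 H] := ucf B e e0; exists del => // z z' Bz Bz' zz'.
apply: fejer_avg_dist => // x x1; apply: H; [exact: polydisc_rot..|move=> i].
by rewrite !updE; case: eqP => // _; rewrite -mulrBl normcM x1 mulr1.
Qed.

Lemma tame_rot j (x : R[i]) f : normc x = 1 -> tame f -> tame (fun z => f (rot j x z)).
Proof.
move=> x1 [bf ucf]; split=> [B|B e e0].
  by have [C HC] := bf B; exists C => z Bz; apply: HC; exact: polydisc_rot.
have [del del0 H] := ucf B e e0; exists del => // z z' Bz Bz' zz'.
apply: H; [exact: polydisc_rot..|move=> i].
by rewrite !updE; case: eqP => // _; rewrite -mulrBl normcM x1 mulr1.
Qed.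

(** At each point Jensen's inequality bounds the integrand by a convex combination, with weights
    [c k], of the integrands of finitely many rotations of [f]; all these have the same energy by
    [energy_rot]. *)
Lemma energy_fejer_avg N n j f : (0 < n <= 2 ^ N)%N -> tame f ->
  (energy (fejer_avg N n j f) <= energy f)%E.
Proof.
move=> nN tf.
pose c k : R := 2 ^- N * fejer n (unity (2 ^ N) ^+ k).
have c0 k : 0 <= c k by rewrite mulr_ge0 ?fejer_ge0// invr_ge0 exprn_ge0.
pose fr k z := f (rot j (unity (2 ^ N) ^+ k) z).
have tfr k : tame (fr k) by apply: tame_rot => //; exact: normc_unityX.
have mfr k : measurable_fun setT (fun t => (integrand (fr k) t)%:E).
  by apply/measurable_EFinP; exact: measurable_integrand.
have le t : integrand (fejer_avg N n j f) t <=
    \sum_(0 <= k < 2 ^ N) c k * integrand (fr k) t.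
  set w : R := weight m beta (to_Cd t).
  pose F x := rnorm (w%:C *: f (rot j x (to_Cd t))).
  apply: (@le_trans _ _ (rmean N (fun x => fejer n x * F x) `^ p)).
    apply: ge0_ler_powR; rewrite ?nnegrE ?rnorm_ge0 ?(ltW p_gt0)//.
      rewrite /rmean mulr_ge0 ?invr_ge0 ?exprn_ge0// sumr_ge0// => k _.
      by rewrite mulr_ge0 ?fejer_ge0 ?rnorm_ge0.
    rewrite /fejer_avg /avg -cmeanZ (le_trans (rnorm_cmean _ _))//.
    apply: ler_rmean => x x1; rewrite scalerA mulrC -scalerA rnormZ normcR.
    by rewrite ger0_norm// fejer_ge0.
  rewrite (le_trans (rmean_powR_le p_ge1 (fejer_ge0 n) _ (rmean_fejer nN)))//.
    by move=> x; exact: rnorm_ge0.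
  by rewrite /rmean mulr_sumr; apply: ler_sum => k _; rewrite mulrA.
apply: (@le_trans _ _ (\int[lebesgue_Cd R d]_t
    (\sum_(0 <= k < 2 ^ N) (c k)%:E * (integrand (fr k) t)%:E))%E).
  apply: ge0_le_integral => //.
  - by move=> t _; rewrite lee_fin integrand_ge0.
  - by apply/measurable_EFinP; apply: measurable_integrand; exact: tame_fejer_avg.
  - by apply: emeasurable_sum => k; exact: measurable_funeM.
  - by move=> t _; under eq_bigr do rewrite -EFinM; rewrite sumEFin lee_fin le.
rewrite ge0_integral_sum; last 3 first.
- exact: measurableT.
- by move=> k; exact: measurable_funeM.
- by move=> k t _; rewrite mule_ge0 ?lee_fin ?integrand_ge0.
rewrite (eq_bigr (fun k => (c k)%:E * energy f)%E) => [|k _]; last first.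
  transitivity ((c k)%:E * energy (fr k))%E.
    apply: (ge0_integralZl_EFin _ measurableT _ (mfr k) (c0 k)).
    by move=> t _; rewrite lee_fin integrand_ge0.
  by rewrite /fr (energy_rot j (normc_unityX _ k) tf).
rewrite -ge0_sume_distrl; last by move=> k _; rewrite lee_fin.
rewrite sumEFin (_ : \sum_(0 <= k < 2 ^ N) c k = 1); first by rewrite mul1e lexx.
by rewrite -(rmean_fejer nN) /rmean mulr_sumr.
Qed.

Lemma integrand_tends (u : nat -> X -> Y) f t :
  tends (u ^~ (to_Cd t)) (f (to_Cd t)) ->
  integrand (u k) t @[k --> \oo] --> integrand f t.
Proof.
move=> uf; rewrite /integrand; apply: cvg_powR => // [k|]; first exact: rnorm_ge0.
set w := (weight m beta (to_Cd t))%:C.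
apply/cvgrPdist_lt => e e0; have := tendsZ w uf e0; apply: filterS => k.
apply: le_lt_trans; rewrite ler_norml; apply/andP; split.
  rewrite lerBrDl lerBlDr addrC; have := rnorm_le_dist (w *: u k (to_Cd t)) (w *: f (to_Cd t)).
  lra.
rewrite lerBlDl; have := rnorm_le_dist (w *: f (to_Cd t)) (w *: u k (to_Cd t)).
by rewrite rnorm_distC.
Qed.

Lemma energy_fejer_mean n j f : (0 < n)%N -> tame f ->
  (energy (fejer_mean n j f) <= energy f)%E.
Proof.
move=> n0 tf.
(* The shift by [n] makes n <= 2^(N + n) true at every index, so each term is [tame] and satisfies
   the bound. *)
pose u N := fejer_avg (N + n) n j f.
have nN N : (0 < n <= 2 ^ (N + n))%N.
  by rewrite n0/= (leq_trans (ltnW (ltn_expl n (ltnSn 1))))// leq_pexp2l// leq_addl.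
have un N : (energy (u N) <= energy f)%E by exact: energy_fejer_avg.
rewrite /energy (_ : \int[lebesgue_Cd R d]_t (integrand (fejer_mean n j f) t)%:E =
    \int[lebesgue_Cd R d]_t limn_einf (fun N => (integrand (u N) t)%:E))%E; last first.
  apply: eq_integral => t _; apply/esym.
  apply: (cvg_limn_einf_sup _).1; apply: cvg_EFin; first by near=> k.
  apply: integrand_tends.
  exact: (tends_shift n (fejer_mean_tends n j (to_Cd t) tf)).
apply: le_trans (fatou _ measurableT _ _) _.
- by move=> N; apply/measurable_EFinP; apply: measurable_integrand; exact: tame_fejer_avg.
- by move=> N t _; rewrite lee_fin integrand_ge0.
rewrite limn_einf_lim; apply: lime_le; first exact: is_cvg_einfs.
near=> N; apply: le_trans (un N).
by apply: ereal_inf_lbound; exists N => /=.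
Unshelve. all: by end_near. Qed.

Lemma energy_torus_fejer n f : (0 < n)%N -> tame f ->
  (energy (torus_fejer n f) <= energy f)%E.
Proof.
move=> n0 tf; rewrite /torus_fejer; elim: (enum _) => [|j s ih] /=; first by rewrite lexx.
by apply: le_trans ih; apply: energy_fejer_mean => //; exact: tame_fejer_iter.
Qed.

(* Fatou's lemma for the nonnegative functions
   [K * (integrand f + integrand (P n)) - integrand (f - P n)]. *)
Lemma energy_dist_le_near f (P : nat -> X -> Y) (e : R) : 0 < e -> tame f ->
  (forall n, tame (P n)) -> (energy f < +oo)%E ->
  (forall n, (energy (P n) <= energy f)%E) ->
  (forall z, tends (P ^~ z) (f z)) ->
  \forall n \near \oo, (energy (fun z => f z - P n z)%R <= e%:E)%E.
Proof.
move=> e0 tf tP Ef EP Pf.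
pose K : R := 2 `^ p / 2.
have K0 : 0 <= K by rewrite divr_ge0 ?powR_ge0.
pose w n t := integrand (fun z => f z - P n z) t.
pose g n t := K * (integrand f t + integrand (P n) t) - w n t.
have tw n : tame (fun z => f z - P n z) by exact: tameB.
have wle n t : w n t <= K * (integrand f t + integrand (P n) t).
  apply: powR_dist_le; rewrite ?rnorm_ge0// scalerBr; exact: rnormB.
have g0 n t : 0 <= g n t by rewrite subr_ge0.
have mI h : tame h -> measurable_fun setT (fun t => (integrand h t)%:E).
  by move=> th; apply/measurable_EFinP; exact: measurable_integrand.
have mg n : measurable_fun setT (fun t => (g n t)%:E).
  apply/measurable_EFinP; apply: measurable_funB; last exact: measurable_integrand.
  apply: measurable_funM => //.
  by apply: measurable_funD; exact: measurable_integrand.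
have I0 h t : (0 <= (integrand h t)%:E)%E by rewrite lee_fin integrand_ge0.
pose G n := (\int[lebesgue_Cd R d]_t (g n t)%:E)%E.
have E0 h : (0 <= energy h)%E by apply: integral_ge0 => t _; exact: I0.
have GE n : (G n + energy (fun z => f z - P n z)%R = K%:E * (energy f + energy (P n)))%E.
  transitivity (\int[lebesgue_Cd R d]_t ((g n t)%:E + (w n t)%:E))%E.
    apply/esym; apply: (ge0_integralD _ measurableT).
    - by move=> t _; rewrite lee_fin.
    - exact: mg.
    - by move=> t _; exact: I0.
    - exact: mI.
  transitivity (\int[lebesgue_Cd R d]_t (K%:E * ((integrand f t)%:E + (integrand (P n) t)%:E)))%E.
    by congr integral; apply/funext => t; rewrite -!EFinD -EFinM subrK.
  transitivity (K%:E * \int[lebesgue_Cd R d]_t ((integrand f t)%:E + (integrand (P n) t)%:E))%E.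
    apply: (ge0_integralZl_EFin _ measurableT _ _ K0).
    - by move=> t _; rewrite adde_ge0.
    - by apply: emeasurable_funD; exact: mI.
  congr (_ * _)%E; apply: (ge0_integralD _ measurableT).
  - by move=> t _; exact: I0.
  - exact: mI.
  - by move=> t _; exact: I0.
  - exact: mI.
(* Pointwise [g n t] tends to 2 K times the integrand of [f], since [w n t] tends to 0. *)
have fatouG : (K%:E * (energy f + energy f) <= limn_einf G)%E.
  have -> : (K%:E * (energy f + energy f))%E =
      (\int[lebesgue_Cd R d]_t limn_einf (fun n => (g n t)%:E))%E.
    transitivity (K%:E * \int[lebesgue_Cd R d]_t ((integrand f t)%:E + (integrand f t)%:E))%E.
      congr (_ * _)%E; apply/esym; apply: (ge0_integralD _ measurableT).
      - by move=> t _; exact: I0.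
      - exact: mI.
      - by move=> t _; exact: I0.
      - exact: mI.
    transitivity (\int[lebesgue_Cd R d]_t (K%:E * ((integrand f t)%:E + (integrand f t)%:E)))%E.
      apply/esym; apply: (ge0_integralZl_EFin _ measurableT _ _ K0).
      - by move=> t _; rewrite adde_ge0.
      - by apply: emeasurable_funD; exact: mI.
    congr integral; apply/funext => t; apply/esym.
    apply: (cvg_limn_einf_sup _).1.
    rewrite -EFinD -EFinM; apply: cvg_EFin; first by near=> k.
    have cP : integrand (P k) t @[k --> \oo] --> integrand f t.
      by apply: integrand_tends; exact: Pf.
    have cw : w k t @[k --> \oo] --> (0 : R).
      have -> : 0 = integrand (fun=> 0) t.
        by rewrite /integrand scaler0 rnorm0 powR0// gt_eqF.
      apply: integrand_tends.
      rewrite -(subrr (f (to_Cd t))); apply: tendsB; last exact: Pf.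
      by move=> r r0; near=> k; rewrite subrr rnorm0.
    rewrite -[K * _]subr0; apply: cvgB => //; apply: cvgM; first exact: cvg_cst.
    by apply: cvgD => //; exact: cvg_cst.
  apply: (fatou _ measurableT mg).
  by move=> n t _; rewrite lee_fin.
have Efin : energy f \is a fin_num by rewrite ge0_fin_numE.
(* This is 2 K times the energy of [f]; its finiteness is what allows subtraction at the end. *)
pose A : R := K * (fine (energy f) + fine (energy f)).
have AE : (A%:E = K%:E * (energy f + energy f))%E.
  by rewrite /A EFinM EFinD !fineK.
have : ((A - e)%:E < limn_einf G)%E.
  by apply: lt_le_trans fatouG; rewrite -AE lte_fin ltrBlDr ltrDl.
rewrite limn_einf_lim (cvg_lim _ (@cvg_einfs_sup R G))// => /ereal_sup_gt[_ [N _ <-]] HN.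
exists N => // n /= Nn.
have Gn : ((A - e)%:E < G n)%E.
  by apply: lt_le_trans HN _; apply: ereal_inf_lbound; exists n.
(* Here the bound on the energy of [P n] is used; with [G n] above [A - e], at most [e] is left for
   the energy of the difference. *)
have : (G n + energy (fun z => f z - P n z)%R <= A%:E)%E.
  by rewrite GE AE lee_wpmul2l// leeD2l.
move: Gn (E0 (fun z => f z - P n z)).
case: (energy _) => [x| |]//; case: (G n) => [y| |]//.
by rewrite -EFinD !lee_fin lte_fin => *; lra.
Unshelve. all: by end_near. Qed.

End energy.
End fock_integrand.

(** * Density in the two families of spaces *)

Section density.
Context {R : realType} {d : nat} {Y : completeNormedModType R[i]}.
Local Notation X := 'rV[R[i]]_d.
Variables (m beta : R).
Hypotheses (m_ge1 : 1 <= m) (beta_gt0 : 0 < beta).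
Implicit Types (f : X -> Y) (z : X).

Lemma cvge_to0 (u : nat -> \bar R) : (forall n, 0 <= u n)%E ->
  (forall e : R, 0 < e -> \forall n \near \oo, (u n <= e%:E)%E) ->
  u @ \oo --> 0%E.
Proof.
move=> u0 H; apply/fine_cvgP; split.
  by apply: filterS (H 1 ltr01) => n un; rewrite ge0_fin_numE// (le_lt_trans un) ?ltry.
apply/cvgrPdist_le => e e0; apply: filterS (H e e0) => n /=.
rewrite sub0r normrN; move: (u0 n); case: (u n) => [r| |]//=.
by rewrite !lee_fin => r0 re; rewrite ger0_norm.
Qed.

Lemma Gamma_ge0 (x : R) : 0 <= Gamma x.
Proof.
apply: fine_ge0; apply: integral_ge0 => t _.
by rewrite lee_fin mulr_ge0 ?powR_ge0 ?expR_ge0.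
Qed.

Lemma fock_const_ge0 : 0 <= fock_const d m beta.
Proof.
rewrite /fock_const !mulr_ge0 ?powR_ge0 ?invr_ge0 ?Gamma_ge0 ?exprn_ge0 ?pi_ge0//.
exact: le_trans m_ge1.
Qed.

Lemma fock_powE p f :
  fock_pow m beta p f = ((fock_const d m beta)%:E * energy m beta p f)%E.
Proof. by []. Qed.

Lemma vpolynomial0 : vpolynomial (fun _ : X => 0 : Y).
Proof. by exists 0, (fun=> 0) => z; rewrite big1// => a _; rewrite scaler0. Qed.

Lemma fock_density p f : 1 <= p -> fock m beta p f ->
  exists P : nat -> X -> Y,
    (forall n, vpolynomial (P n) /\ fock m beta p (P n)) /\
    fock_norm m beta p (fun z => f z - P n z) @[n --> \oo] --> 0%E.
Proof.
move=> p1 [ef Ef]; have tf := entire_tame ef.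
have p0 : 0 < p by exact: lt_le_trans p1.
(* Only nonnegativity of the constant has been established; were it zero, all the norms would vanish
   and the zero polynomial would do. *)
have [C0|Cn0] := eqVneq (fock_const d m beta) 0.
  have pow0 (g : X -> Y) : fock_pow m beta p g = 0%E by rewrite fock_powE C0 mul0e.
  exists (fun _ _ => 0); split=> [n|].
    split; first exact: vpolynomial0.
    by split; [apply: entire_vpolynomial; exact: vpolynomial0|rewrite pow0 ltry].
  rewrite /fock_norm; under eq_fun do rewrite pow0 poweR0r ?invr_eq0 ?gt_eqF//.
  exact: cvg_cst.
have C0 : 0 < fock_const d m beta by rewrite lt_neqAle eq_sym Cn0 fock_const_ge0.
have Ef' : (energy m beta p f < +oo)%E.
  by rewrite ltey; apply: contraTneq Ef => foo; rewrite fock_powE foo gt0_muley ?ltxx.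
(* The order is [n.+1] because the kernel of order 0 is zero. *)
pose P n := torus_fejer n.+1 f.
have EP n : (energy m beta p (P n) <= energy m beta p f)%E.
  exact: energy_torus_fejer.
have vP n : vpolynomial (P n) by exact: vpolynomial_torus_fejer.
exists P; split=> [n|].
  split; first exact: vP.
  split; first exact: entire_vpolynomial.
  rewrite fock_powE; apply: le_lt_trans Ef.
  by rewrite fock_powE lee_wpmul2l// lee_fin ltW.
apply: cvge_to0 => [n|e e0]; first exact: poweR_ge0.
have ep0 : 0 < e `^ p by exact: powR_gt0.
have Pf z : tends (P ^~ z) (f z).
  move=> r r0; have [B B1 Bz] := polydisc_exists z.
  have [n0 Hn0] := torus_fejer_approx B tf (divr_gt0 r0 (ltr0n _ 2)).
  exists n0 => // n /= nn0; apply: (le_lt_trans (Hn0 n.+1 z _ Bz)) => //.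
  by rewrite ltr_pdivrMr// ltr_pMr// ltr1n.
have tP n : tame (P n) by apply: entire_tame; exact: entire_vpolynomial.
(* The tolerance becomes e once multiplied by the constant and raised to the power 1 / p. *)
have := energy_dist_le_near p1 (divr_gt0 ep0 C0) tf tP Ef' EP Pf.
apply: filterS => n En.
have pow_le : (fock_pow m beta p (fun z => f z - P n z)%R <= (e `^ p)%:E)%E.
  rewrite fock_powE.
  have -> : ((e `^ p)%:E = (fock_const d m beta)%:E * (e `^ p / fock_const d m beta)%:E)%E.
    by rewrite -EFinM mulrC divfK.
  by rewrite lee_wpmul2l// lee_fin ltW.
have pow0 : (0 <= fock_pow m beta p (fun z => f z - P n z)%R)%E.
  rewrite fock_powE mule_ge0//; first by rewrite lee_fin ltW.
  by apply: integral_ge0 => t _; rewrite lee_fin integrand_ge0.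
have -> : (e%:E = (e `^ p)%:E `^ p^-1)%E.
  by rewrite poweR_EFin -powRrM divff ?gt_eqF// powRr1// ltW.
by apply: gt0_ler_poweR; rewrite ?in_itv/= ?leey ?andbT ?invr_ge0 ?lee_fin ?(ltW p0) ?(ltW ep0).
Qed.

Lemma weight_le1 z : weight m beta z <= 1.
Proof.
by rewrite -expR0 ler_expR mulNr oppr_le0 mulr_ge0 ?powR_ge0 ?divr_ge0 ?(ltW beta_gt0).
Qed.

Lemma cvg_euclid_inftyP f :
  rnorm (f z) * weight m beta z @[z --> @euclid_infty R d] --> 0 <->
  forall e : R, 0 < e -> exists M, forall z, M < euclid z ->
    rnorm (f z) * weight m beta z <= e.
Proof.
have fw0 z : 0 <= rnorm (f z) * weight m beta z.
  by rewrite mulr_ge0 ?rnorm_ge0 ?(ltW (weight_gt0 _ _ _)).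
split=> [H e e0|H A /nbhs_ballP[e /= e0 eA]].
  have [M _ HM] := H _ (nbhsx_ballx 0 e e0).
  exists M => z /HM; rewrite /ball/= sub0r normrN ger0_norm//; exact: ltW.
have [M HM] := H _ (divr_gt0 e0 (ltr0n _ 2)); exists M => // z /HM fz.
apply: eA; rewrite /ball/= sub0r normrN ger0_norm// (le_lt_trans fz)//.
by rewrite ltr_pdivrMr// ltr_pMr// ltr1n.
Qed.

Lemma fock0_density f : fock0 m beta f ->
  exists P : nat -> X -> Y,
    (forall n, vpolynomial (P n) /\ fock0 m beta (P n)) /\
    fock0_norm m beta (fun z => f z - P n z) @[n --> \oo] --> 0%E.
Proof.
move=> [ef /cvg_euclid_inftyP fw]; have tf := entire_tame ef.
pose P n := torus_fejer n.+1 f.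
(* The torus through [z] lies on one Euclidean sphere, where the weight is constant, so [P n]
   inherits the tail bound of [f] with the same [M] for all [n]. *)
have Pw n z M e : (forall z, M < euclid z -> rnorm (f z) * weight m beta z <= e) ->
    M < euclid z -> rnorm (P n z) * weight m beta z <= e.
  move=> HM Mz; rewrite -ler_pdivlMr ?weight_gt0//.
  apply: torus_fejer_le => // z' zz'.
  rewrite ler_pdivlMr ?weight_gt0// (weight_moduli _ _ (fun i => esym (zz' i))).
  apply: HM; rewrite euclidE; under eq_bigr do rewrite zz'.
  by rewrite -euclidE.
have vP n : vpolynomial (P n) by exact: vpolynomial_torus_fejer.
exists P; split=> [n|].
  split; first exact: vP.
  split; first exact: entire_vpolynomial.
  apply/cvg_euclid_inftyP => e /fw[M HM]; exists M => z; exact: Pw.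
apply: cvge_to0 => [n|e e0].
  apply: le_trans (ereal_sup_ubound _); last by exists 0.
  by rewrite lee_fin mulr_ge0 ?rnorm_ge0 ?(ltW (weight_gt0 _ _ _)).
have [M HM] := fw _ (divr_gt0 e0 (ltr0n _ 2)).
have [n0 Hn0] := torus_fejer_approx M tf e0.
exists n0 => // n /= nn0; apply: ge_ereal_sup => _ [z _ <-]; rewrite lee_fin.
have w0 := weight_gt0 m beta z.
(* Outside the ball both functions contribute at most e / 2; inside it, contained in the polydisc of
   radius [M], the approximation is uniform and the weight is at most 1. *)
have [Mz|zM] := ltP M (euclid z).
  apply: (@le_trans _ _ ((rnorm (f z) + rnorm (P n z)) * weight m beta z)).
    by rewrite ler_wpM2r ?(ltW w0)// rnormB.
  by rewrite mulrDl [leRHS]splitr lerD ?HM// (Pw _ _ M).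
rewrite -[leRHS]mulr1 ler_pM ?rnorm_ge0 ?(ltW w0) ?weight_le1//.
rewrite rnorm_distC; apply: Hn0 => // i.
exact: le_trans (euclid_ge_coord _ _) zM.
Qed.

End density.

Theorem proposition8 (R : realType) (d : nat) (d_ge1 : (1 <= d)%N)
    (m beta : R) (m_ge1 : 1 <= m) (beta_gt0 : 0 < beta)
    (Y : completeNormedModType R[i]) :
  (forall p : R, 1 <= p ->
     forall f : 'rV[R[i]]_d -> Y, fock m beta p f ->
     exists P : nat -> 'rV[R[i]]_d -> Y,
       (forall n, vpolynomial (P n) /\ fock m beta p (P n)) /\
       fock_norm m beta p (fun z => f z - P n z) @[n --> \oo] --> 0%E) /\
  (forall f : 'rV[R[i]]_d -> Y, fock0 m beta f ->
     exists P : nat -> 'rV[R[i]]_d -> Y,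
       (forall n, vpolynomial (P n) /\ fock0 m beta (P n)) /\
       fock0_norm m beta (fun z => f z - P n z) @[n --> \oo] --> 0%E).
Proof. by split=> [p p1 f|f]; [exact: fock_density|exact: fock0_density]. Qed.
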